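(* Let $n,m\in\mathbb{N}$, $(\kappa,k)\in\mathcal{L}_n$, $\kappa\in C_{-1}^{n-1}(0,+\infty)$, $f\in C_{-1}(0,+\infty)$, let $P_m(z)=\sum_{p=0}^{m}c_pz^p$ be a polynomial with real or complex coefficients, $c_m\neq0$, and let $\gamma_0,\dots,\gamma_{m-1}\in\mathrm{Ker}(\mathbb{D}_{(k)})$. The Cauchy problem $$\begin{cases}\sum_{p=0}^{m}c_p(\mathbb{D}_{(k)}^{<p>}y)(t)=f(t), & t>0,\\ (F\,\mathbb{D}_{(k)}^{<p>}y)(t)=\gamma_p(t), & p=0,\dots,m-1,\ t>0,\end{cases}$$ has a unique solution $y$ on the space $C_{-1,(k)}^{(m)}(0,+\infty)$, and it can be represented as $$y(t)=y_f(t)+y_{iv}(t),\quad t>0,$$ where $y_f$ is the unique solution to the Cauchy problem with the homogeneous initial conditions ($\gamma_p(t)\equiv0$, $p=0,\dots,m-1$), in the form $$y_f(t)=\sum_{j=1}^{J}\sum_{i=1}^{m_j}c_{ij}\,(f*l_{\kappa,\lambda_j}^{<i>})(t),\qquad \sum_{j=1}^{J}m_j=m,$$ and $y_{iv}$ is the unique solution to the Cauchy problem for the homogeneous equation ($f(t)\equiv0$), in the form $$y_{iv}(t)=\gamma_0(t)+\sum_{p=0}^{m-1}\sum_{j=1}^{J}\sum_{i=1}^{m_j}c_{ijp}\,(\gamma_p*l_{\kappa,\lambda_j}^{<i>})(t),\qquad \sum_{j=1}^{J}m_j=m.$$ Here $l_{\kappa,\lambda}(t)=\sum_{j=1}^{+\infty}\lambda^{j-1}\kappa^{<j>}(t)$,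 and the constants $\lambda_j$, $c_{ij}$, $c_{ijp}$ are determined by the representations of the rational functions $\frac{1}{P_m(z)}$ and $\frac{P_p(z)}{P_m(z)}$, with $P_p(z)=\sum_{j=1}^{m-p}c_{p+j}z^j$ for $p=0,\dots,m-1$, as sums of partial fractions: $$\frac{1}{P_m(z)}=\frac{1}{c_m(z-\lambda_1)^{m_1}\times\cdots\times(z-\lambda_J)^{m_J}}=\sum_{j=1}^{J}\sum_{i=1}^{m_j}\frac{c_{ij}}{(z-\lambda_j)^i},$$ $$\frac{P_p(z)}{P_m(z)}=\sum_{j=1}^{J}\sum_{i=1}^{m_j}\frac{c_{ijp}}{(z-\lambda_j)^i},\ \ p=1,\dots,m-1;\qquad \frac{P_0(z)}{P_m(z)}=1+\sum_{j=1}^{J}\sum_{i=1}^{m_j}\frac{c_{ij0}}{(z-\lambda_j)^i}.$$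
   Context: Functions are complex-valued functions of $t>0$. $(f*g)(t)=\int_0^t f(t-\tau)g(\tau)\,d\tau$ is the Laplace convolution, and $h_n(t)=t^{n-1}/(n-1)!$ for $n\in\mathbb{N}=\{1,2,\dots\}$. For $i\in\mathbb{N}$, $g^{<i>}=g*\cdots*g$ ($i$ factors). The $\lambda_1,\dots,\lambda_J\in\mathbb{C}$ are the distinct roots of $P_m$, with multiplicities $m_1,\dots,m_J$. $C_{-1}(0,+\infty)=\{f:\ f(t)=t^pf_1(t),\ t>0,\ p>-1,\ f_1\in C[0,+\infty)\}$. $C_{-1,0}(0,+\infty)=\{f:\ f(t)=t^pf_1(t),\ t>0,\ -1<p<0,\ f_1\in C[0,+\infty)\}$. For $l\in\mathbb{N}_0$, $C_{-1}^l(0,+\infty)=\{f\in C_{-1}(0,+\infty):\ f^{(l)}\in C_{-1}(0,+\infty)\}$ (derivative taken on $(0,+\infty)$). $\mathcal{L}_n$ is the set of pairs $(\kappa,k)$ with $\kappa\in C_{-1}(0,+\infty)$, $k\in C_{-1,0}(0,+\infty)$ and $(\kappa*k)(t)=h_n(t)$ for all $t>0$. General fractional derivative of Riemann-Liouville type: $(\mathbb{D}_{(k)}f)(t)=\frac{d^n}{dt^n}(k*f)(t)$, $t>0$. The sequential derivative $\mathbb{D}_{(k)}^{<p>}$ is the $p$-fold composition of $\mathbb{D}_{(k)}$ with itself (identity for $p=0$). $C_{-1,(k)}^{(m)}(0,+\infty)=\{f\in C_{-1}(0,+\infty):\ \mathbb{D}_{(k)}^{<i>}f\in C_{-1}(0,+\infty),\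 i=1,\dots,m\}$. $\mathrm{Ker}(\mathbb{D}_{(k)})$ is the null space of $\mathbb{D}_{(k)}$ on $C_{-1,(k)}^{(1)}(0,+\infty)$. Projector operator of $\mathbb{D}_{(k)}$: $$(Ff)(t)=f(t)-(\kappa*\mathbb{D}_{(k)}f)(t)=\sum_{i=0}^{n-1}\left(\frac{d^i}{dt^i}(k*f)\right)(0)\,\frac{d^{\,n-1-i}\kappa}{dt^{\,n-1-i}}(t),\quad t>0,\ f\in C_{-1,(k)}^{(1)}(0,+\infty),$$ with values at $0$ understood as limits for $t\to0+$. In the series for $l_{\kappa,\lambda}$, $\lambda^0=1$; the series is known to converge for all $t>0$ and to define a function in $C_{-1}(0,+\infty)$. *)

(* Defs.v *)
From HB Require Import structures.
From mathcomp Require Import all_boot all_order all_algebra.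
From mathcomp Require Import all_classical all_reals all_analysis.
From mathcomp Require Import complex.

Set Implicit Arguments.
Unset Strict Implicit.
Unset Printing Implicit Defensive.

Import Order.TTheory GRing.Theory Num.Theory numFieldNormedType.Exports.

Local Open Scope classical_set_scope.
Local Open Scope ring_scope.
Local Open Scope complex_scope.

(* A function on (0,+oo) is a total function [R -> R[i]] of which only the
   values at [t > 0] are meaningful: every operation below, evaluated at
   [t > 0], depends only on the values of its arguments on (0,+oo).
   [R[i]^o] is [R[i]] with the topology of its norm. *)

Section ComplexCalculus.
Variable R : realType.
Implicit Types (f g : R -> R[i]) (t : R).

(* [R[i]] is not a normed module over [R] in the library: derivatives and
   integrals of complex-valued functions are taken componentwise. *)
Definition cderivable f t : Prop :=
  derivable (fun x => complex.Re (f x)) t 1 /\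
  derivable (fun x => complex.Im (f x)) t 1.

Definition cderive f : R -> R[i] := fun t =>
  derive1 (fun x => complex.Re (f x)) t +i*
  derive1 (fun x => complex.Im (f x)) t.

Definition cderiven (l : nat) f : R -> R[i] := iter l cderive f.

(* The derivatives of orders 1, ..., l exist on (0,+oo); [cderive] alone is a
   total operator and does not guarantee this. *)
Definition cderivablen (l : nat) f : Prop :=
  forall i, (i < l)%N -> forall t, 0 < t -> cderivable (cderiven i f) t.

Definition cintegral (D : set R) f : R[i] :=
  Rintegral lebesgue_measure D (fun x => complex.Re (f x)) +i*
  Rintegral lebesgue_measure D (fun x => complex.Im (f x)).

End ComplexCalculus.

Section Convolution.
Variable R : realType.
Implicit Types (f g : R -> R[i]) (t : R).

Definition lconv f g : R -> R[i] := fun t =>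
  cintegral `]0, t[ (fun tau => f (t - tau) * g tau).

(* [lconvpow g i] is g * ... * g with i factors, for [1 <= i]
   ([lconvpow g 0] is a junk value). *)
Definition lconvpow g (i : nat) : R -> R[i] := iter i.-1 (lconv g) g.

Definition hfun (n : nat) : R -> R[i] := fun t =>
  (t ^+ n.-1 / (n.-1)`!%:R)%:C.

(* The summation index is shifted by one with respect to the usual
   sum over j >= 1 of lambda^(j-1) kappa^<j>. *)
Definition lfun (kappa : R -> R[i]) (lambda : R[i]) : R -> R[i] := fun t =>
  lim (series (fun j => lambda ^+ j * lconvpow kappa j.+1 t : R[i]^o) @ \oo).

End Convolution.

Section Spaces.
Variable R : realType.
Implicit Types (f : R -> R[i]).

Definition inCm1 f : Prop :=
  exists (p : R) (f1 : R -> R[i]^o),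
    [/\ -1 < p,
        {within `[0, +oo[, continuous f1} &
        forall t, 0 < t -> f t = (t `^ p)%:C * f1 t].

Definition inCm10 f : Prop :=
  exists (p : R) (f1 : R -> R[i]^o),
    [/\ -1 < p, p < 0,
        {within `[0, +oo[, continuous f1} &
        forall t, 0 < t -> f t = (t `^ p)%:C * f1 t].

Definition inCm1l (l : nat) f : Prop :=
  [/\ inCm1 f, cderivablen l f & inCm1 (cderiven l f)].

Definition Lclass (n : nat) (kappa k : R -> R[i]) : Prop :=
  [/\ inCm1 kappa, inCm10 k &
      forall t, 0 < t -> lconv kappa k t = hfun n t].

End Spaces.

Section GeneralFractionalDerivative.
Variables (R : realType) (n : nat) (kappa k : R -> R[i]).
Implicit Types (f y : R -> R[i]).

Definition gfd f : R -> R[i] := cderiven n (lconv k f).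

Definition gfdn (p : nat) f : R -> R[i] := iter p gfd f.

Definition inCm1k (m : nat) f : Prop :=
  inCm1 f /\
  forall i, (i < m)%N ->
    cderivablen n (lconv k (gfdn i f)) /\ inCm1 (gfdn i.+1 f).

Definition inKer f : Prop :=
  inCm1k 1 f /\ forall t, 0 < t -> gfd f t = 0.

Definition projector f : R -> R[i] := fun t => f t - lconv kappa (gfd f) t.

Definition cauchy_solution (m : nat) (c : nat -> R[i]) (f : R -> R[i])
    (gam : nat -> R -> R[i]) y : Prop :=
  [/\ inCm1k m y,
      forall t, 0 < t -> \sum_(p < m.+1) c p * gfdn p y t = f t &
      forall p, (p < m)%N ->
        forall t, 0 < t -> projector (gfdn p y) t = gam p t].

Definition unique_cauchy_solution (m : nat) (c : nat -> R[i]) (f : R -> R[i])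
    (gam : nat -> R -> R[i]) y : Prop :=
  cauchy_solution m c f gam y /\
  forall y', cauchy_solution m c f gam y' -> forall t, 0 < t -> y' t = y t.

End GeneralFractionalDerivative.

Section PartialFractions.
Variables (R : realType) (J : nat) (lam : 'I_J -> R[i]) (mult : 'I_J -> nat).

Definition charpol (m : nat) (c : nat -> R[i]) : {poly R[i]} :=
  \poly_(p < m.+1) c p.

Definition numpol (m : nat) (c : nat -> R[i]) (p : nat) : {poly R[i]} :=
  \sum_(1 <= j < (m - p).+1) c (p + j)%N *: 'X^j.

(* N / D = e + sum_j sum_(1 <= i <= mult j) a j i / ('X - lam j)^i as rational
   functions, i.e. at every point that is not a root of D. *)
Definition is_partial_fraction (N D : {poly R[i]}) (e : R[i])
    (a : 'I_J -> nat -> R[i]) : Prop :=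
  forall z, D.[z] != 0 ->
    N.[z] / D.[z] =
      e + \sum_(j < J) \sum_(1 <= i < (mult j).+1) a j i / (z - lam j) ^+ i.

Definition partial_fraction_coefs (N D : {poly R[i]}) (e : R[i])
    (a : 'I_J -> nat -> R[i]) : Prop :=
  is_partial_fraction N D e a /\
  forall a', is_partial_fraction N D e a' ->
    forall j i, (1 <= i <= mult j)%N -> a' j i = a j i.

End PartialFractions.

(* Main.v *)
Require Import Defs.
From HB Require Import structures.
From mathcomp Require Import all_boot all_order all_algebra.
From mathcomp Require Import all_classical all_reals all_analysis.
From mathcomp Require Import measurable_realfun complex zify ring lra.

(** Convolution makes the functions of class C_{-1} a commutative algebra
    without unit. After a unit is adjoined, the Cauchy problem becomes a
    linear equation in a commutative ring, and the theorem says that its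
    coefficient is invertible, with an inverse read off from partial
    fractions.

    Write K for kappa, D for the fractional derivative and P for the
    polynomial with coefficients c_p. The initial conditions say that D^<p>
    y = gamma_p + K D^<p+1> y for p < m. Conversely, since kappa * k = h_n,
    convolution of kappa * g with k yields the n-fold primitive of g, so
    that D (gamma + K g) = g for gamma in the kernel of D: this is
    [gfd_step]. Multiply the equation by K^m and replace each K D^<p+1> y by
    D^<p> y - gamma_p. An Abel summation, [cauchy_identity], leaves Q y =
    K^m f + sum_p (K^m P_p(1/K)) gamma_p, where Q = K^m P(1/K) = c_m prod_j
    (1 - lambda_j K)^(m_j).

    The function l = l_{kappa,lambda} is the Neumann series of K / (1 -
    lambda K), that is l = K + lambda K l ([resolvent_exists]). Hence 1 -
    lambda_j K has the inverse 1 + lambda_j l_j, and Q is invertible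
    ([homog_denom_inv]). This gives uniqueness. For existence, the D^<p> y
    are written in terms of the single unknown v = D^<m> y, and the equation
    becomes Q v = a known function ([cauchy_solution_exists]). For the
    formula, the polynomial identity behind a partial fraction decomposition
    is homogenized, which amounts to putting z = 1/K: then 1/(z - lambda)
    becomes l, and K^m / Q and K^m P_p(1/K) / Q become the announced sums of
    powers of the l_j ([homog_pfsum]).

    The analysis supplies this ring. A function of C_{-1} is represented by
    its extension by 0 to t <= 0, which is continuous for t > 0 and, on each
    (0,T], bounded by a multiple of t^p for some p > -1 ([inCm1_causal],
    [cCm1_inCm1]). Convolution is then an integral over the whole line.
    Commutativity is an affine substitution, associativity is Fubini, and
    stability of the class comes from the Beta integral; all this is done
    for real functions and transferred to complex ones by real and imaginary
    parts. The Neumann series converges because, on (0,T] and in a norm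
    weighted by e^(-st), convolution with kappa has a norm that tends to 0
    as s grows ([rconv_weighted_le]). *)

Set Implicit Arguments.
Unset Strict Implicit.
Unset Printing Implicit Defensive.

Import Order.TTheory GRing.Theory Num.Theory numFieldNormedType.Exports.

Local Open Scope classical_set_scope.
Local Open Scope ring_scope.

(** * Affine substitution in Lebesgue integrals *)

Section AffineSubstitution.
Variable R : realType.
Notation mu := (@lebesgue_measure R).

Definition affine (a b : R) (x : measurableTypeR R) : measurableTypeR R :=
  a * x + b.

Lemma measurable_affine (a b : R) : measurable_fun setT (affine a b).
Proof. by apply: measurable_funD => //; exact: mulrl_measurable. Qed.

Lemma preimage_affine_ocitv (a b c d : R) : a != 0 ->
  affine a b @^-1` `]c, d] =
  if 0 < a then `](c - b) / a, (d - b) / a]%classic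
  else `[(d - b) / a, (c - b) / a[%classic.
Proof.
move=> a0; apply/seteqP; split=> x; rewrite /affine /=; case: ifPn => [a1|a1];
  rewrite /= !in_itv/=;
  try (have {}a1 : a < 0 by rewrite lt_neqAle a0 leNgt);
  rewrite ?(ler_pdivrMr _ _ a1, ltr_pdivrMr _ _ a1, ler_pdivlMr _ _ a1,
    ltr_pdivlMr _ _ a1) ?(ler_ndivrMr _ _ a1, ltr_ndivrMr _ _ a1,
    ler_ndivlMr _ _ a1, ltr_ndivlMr _ _ a1) => /andP[h1 h2];
  by apply/andP; split; lra.
Qed.

(** The image of mu under an affine map, scaled by the slope, agrees with mu
    on half-open intervals, and these determine the measure. *)
Lemma lebesgue_measure_affine (a b : R) (A : set R) : a != 0 -> measurable A ->
  mu A = (`|a|%:E * mu (affine a b @^-1` A))%E.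
Proof.
move=> a0 mA; have mf := measurable_affine a b.
pose m : {measure set (measurableTypeR R) -> \bar R} :=
  mscale (NngNum (normr_ge0 a))
    (measure_function_pushforward__canonical__measure_function_Measure mu mf).
rewrite -[RHS]/(m A); apply: (@lebesgue_measure_unique _ m) => // _ [[c d] _ <-].
rewrite -[RHS]/(`|a|%:E * mu (affine a b @^-1` `]c, d]))%E preimage_affine_ocitv// (fun_if lebesgue_measure).
rewrite !lebesgue_measure_itv/= !lte_fin -!EFinD.
have [a1|a1] := boolP (0 < a).
  rewrite ltr_pM2r ?invr_gt0// ltrD2r gtr0_norm//; case: ifPn => _; last by rewrite mule0.
  by rewrite -EFinM; congr EFin; field.
have {}a1 : a < 0 by rewrite lt_neqAle a0 leNgt.
rewrite ltr_nM2r ?invr_lt0// ltrD2r ltr0_norm//; case: ifPn => _; last by rewrite mule0.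
by rewrite -EFinM; congr EFin; field.
Qed.

Local Open Scope ereal_scope.

Lemma ge0_integral_affine (a b : R) (f : R -> \bar R) : a != 0%R ->
  measurable_fun setT f -> (forall x, 0 <= f x) ->
  \int[mu]_x f x = `|a|%:E * \int[mu]_x f (a * x + b)%R.
Proof.
move=> a0 mf f0; have mg := measurable_affine a b.
pose m1 := measure_function_pushforward__canonical__measure_function_Measure mu mg.
transitivity (\int[mscale (NngNum (normr_ge0 a)) m1]_x f x).
  by apply: eq_measure_integral => //= A mA _; rewrite (lebesgue_measure_affine b a0).
by rewrite ge0_integral_mscale// ge0_integral_pushforward// preimage_setT.
Qed.

Lemma measurable_comp_affine (a b : R) (f : R -> R) : measurable_fun setT f ->
  measurable_fun setT (fun x : R => f (a * x + b)%R).
Proof. by move=> mf; apply: (measurableT_comp mf); exact: measurable_affine. Qed.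

Lemma integrable_affine (a b : R) (f : R -> R) : a != 0%R ->
  mu.-integrable setT (EFin \o f) ->
  mu.-integrable setT (fun x => (f (a * x + b)%R)%:E).
Proof.
move=> a0 /integrableP[/measurable_EFinP mf foo]; apply/integrableP; split.
  by apply/measurable_EFinP; exact: measurable_comp_affine.
move: foo; rewrite (@ge0_integral_affine a b)//=; last first.
  by apply/measurable_EFinP; exact: measurableT_comp.
rewrite !ltey; apply: contraNN => /eqP ->. by rewrite gt0_muley// lte_fin normr_gt0.
Qed.

Lemma Rintegral_affine (a b : R) (f : R -> R) : a != 0%R ->
  mu.-integrable setT (EFin \o f) ->
  (\int[mu]_x f x = `|a| * \int[mu]_x f (a * x + b))%R.
Proof.
move=> a0 intf; have intg := integrable_affine b a0 intf.
have [/measurable_EFinP mf _] := integrableP _ _ _ intf.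
rewrite -RintegralZl// /Rintegral; congr fine.
under [RHS]eq_integral do rewrite EFinM.
rewrite integralZl// integralE (@ge0_integral_affine a b)//; last first.
  by apply: measurable_funepos; exact/measurable_EFinP.
rewrite [X in _ - X](@ge0_integral_affine a b)//; last first.
  by apply: measurable_funeneg; exact/measurable_EFinP.
rewrite [X in _ = _ * X]integralE [RHS]muleBr//.
  by congr (_ * _ - _ * _); apply: eq_integral => x _; rewrite !(funeposE, funenegE).
by rewrite fin_num_adde_defr// integrable_pos_fin_num.
Qed.

End AffineSubstitution.

(** * Powers on the half-line and Beta integrals *)

Section PowerFunctions.
Variable R : realType.
Notation mu := (@lebesgue_measure R).
Implicit Types (p q r t x : R).

(** Powers are continued by 0 to the left so that the convolution of two of
    them is an integral over the whole line. *)
Definition ppow p x : R := if 0 < x then x `^ p else 0.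

Lemma ppow_ge0 p x : 0 <= ppow p x.
Proof. by rewrite /ppow; case: ifP => // _; exact: powR_ge0. Qed.

Lemma ppow_le0 p x : x <= 0 -> ppow p x = 0.
Proof. by rewrite /ppow ltNge => ->. Qed.

Lemma ppow_gt0 p x : 0 < x -> ppow p x = x `^ p.
Proof. by rewrite /ppow => ->. Qed.

Lemma ppowZ p t x : 0 < t -> ppow p (t * x) = t `^ p * ppow p x.
Proof.
move=> t0; rewrite /ppow pmulr_rgt0//; case: ifPn => x0; last by rewrite mulr0.
by rewrite powRM// ltW.
Qed.

Lemma measurable_ppow p : measurable_fun setT (ppow p).
Proof.
apply: (@measurable_fun_ifT _ _ _ _ (@powR R ^~ p) (cst 0) (fun x => 0 < x)) => //.
  exact: measurable_fun_ltr.
Qed.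

Lemma continuous_powR p x : 0 < x -> {for x, continuous (@powR R ^~ p)}.
Proof.
move=> x0; apply: differentiable_continuous; apply/derivable1_diffP.
by apply: derivable_powR; rewrite in_itv/= x0.
Qed.

(** The bound does not depend on a: letting a tend to 0 yields integrability
    up to 0. *)
Lemma integral_powR_le q a : -1 < q -> 0 < a -> a < 1 ->
  (\int[mu]_(x in `[a, 1%R]) (x `^ q)%:E <= ((q + 1)^-1)%:E)%E.
Proof.
move=> q1 a0 a1.
have q0 : 0 < q + 1 by rewrite -ltrBlDr sub0r.
pose F x := (q + 1)^-1 * x `^ (q + 1).
have dF x : 0 < x -> is_derive x 1 F (x `^ q).
  move=> x0; rewrite /F.
  have := is_deriveZ ((q + 1)^-1) (is_derive1_powR (q + 1) x0).
  rewrite addrK /GRing.scale/= mulKf// gt_eqF//.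
rewrite (@continuous_FTC2 _ _ F)//.
- rewrite -EFinD lee_fin /F powR1 mulr1 gerBl mulr_ge0 ?powR_ge0// invr_ge0; exact: ltW.
- apply: continuous_in_subspaceT => x /set_mem/=; rewrite in_itv/= => /andP[ax _].
  exact/continuous_powR/lt_le_trans/ax.
- have cF x : 0 < x -> F y @[y --> x] --> F x.
    move=> x0; apply: differentiable_continuous; apply/derivable1_diffP.
    by have [] := dF x x0.
  split.
  + by move=> x; rewrite in_itv/= => /andP[ax _]; have [] := dF x (lt_trans a0 ax).
  + exact/cvg_at_right_filter/cF.
  + exact/cvg_at_left_filter/cF.
- move=> x; rewrite in_itv/= => /andP[ax _].
  by rewrite derive1E; have [_ ->] := dF x (lt_trans a0 ax).
Qed.

(** A power is monotone on the half-line, in a direction that depends on the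
    sign of r; the sum of the end values is a bound in both cases. *)
Lemma powR_le_ends r a b x : 0 < a -> a <= x <= b -> x `^ r <= a `^ r + b `^ r.
Proof.
move=> a0 /andP[ax xb]; have x0 := lt_le_trans a0 ax.
have [r0|r0] := leP 0 r.
  by rewrite -[leLHS]add0r lerD ?powR_ge0// ge0_ler_powR ?nnegrE ?(le_trans _ xb)// ltW.
rewrite -[leLHS]addr0 lerD ?powR_ge0// -[r]opprK powRN [leRHS]powRN.
rewrite lef_pV2 ?posrE ?powR_gt0//.
by rewrite ge0_ler_powR ?nnegrE ?oppr_ge0 ?(ltW r0)// ltW.
Qed.

(** The integrand of the Beta function of p + 1 and q + 1, continued by 0
    outside of (0,1). *)
Definition beta_integrand p q x : R := ppow p (1 - x) * ppow q x.

Lemma measurable_beta_integrand p q : measurable_fun setT (beta_integrand p q).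
Proof.
apply: measurable_funM; last exact: measurable_ppow.
apply: (measurableT_comp (measurable_ppow p)).
exact: measurable_funB.
Qed.

(** Monotone convergence along the intervals [1/(n+2), 1], on which the
    fundamental theorem of calculus applies. *)
Lemma integrable_powR q : -1 < q ->
  mu.-integrable `]0, 1] (fun x => (x `^ q)%:E).
Proof.
move=> q1; apply/integrableP; split.
  by apply/measurable_EFinP/measurable_funTS; exact: measurable_powR.
pose F (n : nat) : set R := `[n.+2%:R^-1, 1]%classic.
have UF : `]0, 1]%classic = \bigcup_n F n.
  apply/seteqP; split=> x /=; rewrite /F.
    rewrite in_itv/= => /andP[x0 x1].
    have [n nx] : exists n : nat, x^-1 < n%:R.
      by exists (Num.bound x^-1); apply: archi_boundP; rewrite invr_ge0 ltW.
    exists n => //=; rewrite in_itv/= x1 andbT invf_ple ?posrE//.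
    by rewrite (le_trans (ltW nx))// ler_nat -addn2 leq_addr.
  move=> [n _] /=; rewrite !in_itv/= => /andP[nx ->]; rewrite andbT.
  by rewrite (lt_le_trans _ nx)// invr_gt0.
rewrite UF.
apply: (@le_lt_trans _ _ ((q + 1)^-1)%:E); last by rewrite ltry.
have ndF : nondecreasing_seq F.
  move=> n m nm; apply/subsetPset => x /=; rewrite /F/= !in_itv/= => /andP[nx ->].
  by rewrite andbT (le_trans _ nx)// lef_pV2 ?posrE// ler_nat.
have mF n : measurable_fun (F n) (fun x => `|(x `^ q)%:E|%E).
  apply/measurableT_comp => //.
  by apply/measurable_EFinP/measurable_funTS; exact: measurable_powR.
have mFn n : measurable (F n) by exact: measurable_itv.
have cv : (\int[mu]_(x in F i) `|(x `^ q)%:E| @[i --> \oo] -->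
    \int[mu]_(x in \bigcup_i F i) `|(x `^ q)%:E|)%E.
  exact: ge0_nondecreasing_set_cvg_integral.
rewrite -(cvg_lim _ cv)//; apply: lime_le.
  apply: ereal_nondecreasing_is_cvgn.
  exact: ge0_nondecreasing_set_nondecreasing_integral.
apply: nearW => n.
under eq_integral do rewrite gee0_abs ?lee_fin ?powR_ge0//.
apply: integral_powR_le => //; rewrite ?invr_gt0 ?invf_lt1//.
by rewrite ltr1n.
Qed.

Lemma integrable_beta_integrand0 q : -1 < q -> mu.-integrable setT (EFin \o beta_integrand 0 q).
Proof.
move=> q1; have := integrable_powR q1.
rewrite (integrable_mkcond _ _)//; apply: le_integrable => //.
  apply/measurable_EFinP; exact: measurable_beta_integrand.
move=> x _; rewrite /= patchE; case: ifPn => [|xi].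
  rewrite inE/= in_itv/= => /andP[x0 x1]; rewrite lee_fin /beta_integrand /ppow x0.
  case: ifP => _; last by rewrite mul0r normr0.
  by rewrite powRr0 mul1r.
rewrite lee_fin /beta_integrand /ppow subr_gt0; case: ifPn => x1; last by rewrite mul0r normr0.
case: ifPn => x0; last by rewrite mulr0 normr0.
by move: xi; rewrite notin_setE/= in_itv/= x0 ltW.
Qed.

(** Near each of the two ends only one factor is singular and the other one
    is bounded; the reflection x |-> 1 - x exchanges the two ends. *)
Lemma integrable_beta_integrand p q : -1 < p -> -1 < q ->
  mu.-integrable setT (EFin \o beta_integrand p q).
Proof.
move=> p1 q1; pose C := 2 + 2^-1 `^ p + 2^-1 `^ q.
have Hq := integrable_beta_integrand0 q1.
have n1 : -1 != 0 :> R by rewrite oppr_eq0 oner_eq0.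
have Hp := integrable_affine 1 n1 (integrable_beta_integrand0 p1).
have : mu.-integrable setT (fun x => C%:E * ((beta_integrand 0 q x)%:E + (beta_integrand 0 p (-1 * x + 1))%:E))%E.
  by apply: integrableZl => //; apply: integrableD => //.
apply: le_integrable => //.
  apply/measurable_EFinP; exact: measurable_beta_integrand.
move=> x _; rewrite /= lee_fin ger0_norm ?mulr_ge0 ?ppow_ge0// ler_normr; apply/orP; left.
rewrite /beta_integrand opprD mulNr opprK mul1r addrCA subrr addr0 /ppow.
have bnd r y : 2^-1 <= y -> y <= 1 -> y `^ r <= 1 + 2^-1 `^ r.
  move=> y1 y2; have -> : 1 + 2^-1 `^ r = 2^-1 `^ r + 1 `^ r by rewrite addrC powR1.
  by apply: powR_le_ends; rewrite ?y1.
rewrite [- x + 1]addrC.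
have P r := powR_ge0 (2^-1 : R) r.
(* Outside of (0,1) both sides vanish; inside, the two cases are the halves
   of the interval. *)
have [x1|x1] := ltP 0 (1 - x); last by rewrite !mul0r !mulr0 addr0 mulr0.
have [x0|x0] := ltP 0 x; last by rewrite !mul0r !mulr0 addr0 mulr0.
have Ax := powR_ge0 x q; have Bx := powR_ge0 (1 - x) p.
rewrite !powRr0 !mul1r /C.
have [hx|hx] := leP x 2^-1.
  have H : (1 - x) `^ p <= 1 + 2^-1 `^ p by apply: bnd; lra.
  have := P p; have := P q; nra.
have H : x `^ q <= 1 + 2^-1 `^ q by apply: bnd; lra.
have := P p; have := P q; nra.
Qed.

End PowerFunctions.

(** * Convolution of causal real functions *)

Section RealConvolution.
Variable R : realType.
Notation mu := (@lebesgue_measure R).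
Implicit Types (p q r t x : R) (u v w : R -> R).

(** Since the power vanishes for x <= 0, a bound for all x <= T also encodes
    causality. *)
Definition ppow_bounded p u : Prop := forall T, 0 < T ->
  exists2 M, 0 <= M & forall x, x <= T -> `|u x| <= M * ppow p x.

(** The real functions of C_{-1}, extended by 0: if f(t) = t^p f_1(t) with
    f_1 continuous on [0,oo), then f is O(t^p) on each (0,T]. The converse
    costs an arbitrarily small part of the exponent, which is harmless
    because p > -1 is an open condition. *)
Definition rCm1 u : Prop :=
  (forall x, 0 < x -> {for x, continuous u}) /\ exists2 p, -1 < p & ppow_bounded p u.

Lemma ppow_bounded_causal p u x : ppow_bounded p u -> x <= 0 -> u x = 0.
Proof.
move=> /(_ 1 ltr01)[M _ Mu] x0; apply/normr0_eq0/le_anti.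
by rewrite normr_ge0 andbT (le_trans (Mu x _)) ?ppow_le0 ?mulr0// (le_trans x0).
Qed.

Lemma ppow_weaken p q x T : q <= p -> x <= T -> 0 < T ->
  ppow p x <= T `^ (p - q) * ppow q x.
Proof.
move=> qp xT T0; have [x0|x0] := ltP 0 x; last by rewrite !ppow_le0// mulr0.
rewrite !ppow_gt0// -[X in x `^ X](subrK q p) (@powRD _ x (p - q)); last by rewrite (gt_eqF x0) implybT.
rewrite ler_wpM2r ?powR_ge0//; apply: ge0_ler_powR; rewrite ?nnegrE ?subr_ge0//; exact: ltW.
Qed.

Lemma ppow_bounded_weaken p q u : q <= p -> ppow_bounded p u -> ppow_bounded q u.
Proof.
move=> qp up T T0; have [M M0 Mu] := up _ T0.
exists (M * T `^ (p - q)); first by rewrite mulr_ge0 ?powR_ge0.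
move=> x xT; rewrite (le_trans (Mu x xT))// -mulrA ler_wpM2l//.
exact: ppow_weaken.
Qed.

Lemma rCm1_causal u x : rCm1 u -> x <= 0 -> u x = 0.
Proof. by move=> [_ [p _ /ppow_bounded_causal]]; apply. Qed.

Lemma rCm1_measurable u : rCm1 u -> measurable_fun setT u.
Proof.
move=> uC; have -> : [set: R] = `]0, +oo[%classic `|` `]-oo, 0]%classic.
  apply/seteqP; split=> // x _ /=; rewrite !in_itv/= andbT.
  by case: (ltP 0 x); [left|right].
apply/measurable_funU => //; split.
  apply: open_continuous_measurable_fun => //.
  move=> x; rewrite inE/= in_itv/= andbT => x0; exact: (uC.1).
have m0 : measurable_fun (`]-oo, 0]%classic : set R) (cst 0 : R -> R) by [].
apply: (eq_measurable_fun _ _ m0) => x; rewrite inE/= in_itv/= => x0.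
by rewrite (rCm1_causal uC).
Qed.

Lemma rCm1_norm u : rCm1 u -> rCm1 (fun x => `|u x|).
Proof.
move=> [cu [p p1 pu]]; split.
  by move=> x x0; apply: cvg_norm; exact: cu.
exists p => // T T0; have [M M0 Mu] := pu _ T0; exists M => // x xT.
by rewrite normr_id Mu.
Qed.

Lemma rCm1Z a u : rCm1 u -> rCm1 (fun x => a * u x).
Proof.
move=> [cu [p p1 pu]]; split.
  by move=> x x0; apply: cvgMr; exact: cu.
exists p => // T T0; have [M M0 Mu] := pu _ T0; exists (`|a| * M); first exact: mulr_ge0.
by move=> x xT; rewrite normrM -mulrA ler_wpM2l// Mu.
Qed.

Lemma rCm1D u v : rCm1 u -> rCm1 v -> rCm1 (fun x => u x + v x).
Proof.
move=> [cu [p p1 pu]] [cv [q q1 qv]]; split.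
  by move=> x x0; apply: cvgD; [exact: cu|exact: cv].
exists (Num.min p q); first by rewrite lt_min p1.
have [mp mq] : Num.min p q <= p /\ Num.min p q <= q by rewrite !ge_min !lexx orbT.
have {}pu := ppow_bounded_weaken mp pu.
have {}qv := ppow_bounded_weaken mq qv.
move=> T T0; have [M M0 Mu] := pu _ T0; have [N N0 Nv] := qv _ T0.
exists (M + N); first exact: addr_ge0.
by move=> x xT; rewrite mulrDl (le_trans (ler_normD _ _))// lerD ?Mu ?Nv.
Qed.

Lemma rCm1_0 : rCm1 (fun=> 0).
Proof.
split=> [x _|]; first exact: cvg_cst.
exists 0 => // T T0; exists 0 => // x _; by rewrite normr0 mul0r.
Qed.

Definition rconv u v t : R := \int[mu]_x (u (t - x) * v x).

Definition euler_beta p q : R := \int[mu]_x beta_integrand p q x.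

(** Homogeneity, in the shape of an affine substitution: 0 is the constant
    term. *)
Lemma ppow_conv_affine p q t x : 0 < t ->
  ppow p (t - x) * ppow q x = t `^ (p + q) * beta_integrand p q (t^-1 * x + 0).
Proof.
move=> t0; rewrite addr0 /beta_integrand powRD ?(gt_eqF t0) ?implybT//.
rewrite [RHS]mulrACA -!ppowZ// mulrBr mulr1 mulVKf ?gt_eqF//.
Qed.

Lemma integrable_ppow_conv p q t : -1 < p -> -1 < q ->
  mu.-integrable setT (fun x => (ppow p (t - x) * ppow q x)%:E).
Proof.
move=> p1 q1; have [t0|t0] := ltP 0 t; last first.
  rewrite (_ : (fun _ => _) = cst 0%E); first exact: integrable0.
  apply/funext => x /=; have [x0|x0] := leP x 0; first by rewrite (ppow_le0 q)// mulr0.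
  by rewrite ppow_le0 ?mul0r// subr_le0 (le_trans t0)// ltW.
under eq_fun do rewrite ppow_conv_affine// EFinM.
apply: integrableZl => //.
by apply: integrable_affine; [rewrite invr_eq0 gt_eqF|exact: integrable_beta_integrand].
Qed.

(** The substitution x = t s takes the integrand to a multiple of the Beta
    integrand, because powers are homogeneous. *)
Lemma rconv_ppow p q t : -1 < p -> -1 < q ->
  rconv (ppow p) (ppow q) t = euler_beta p q * ppow (p + q + 1) t.
Proof.
move=> p1 q1; have [t0|t0] := ltP 0 t; last first.
  have H x : ppow p (t - x) * ppow q x = 0.
    have [x0|x0] := leP x 0; first by rewrite (ppow_le0 q)// mulr0.
    by rewrite ppow_le0 ?mul0r// subr_le0 (le_trans t0)// ltW.
  rewrite ppow_le0// mulr0 /rconv; under eq_Rintegral do rewrite H.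
  by rewrite Rintegral_cst// mul0r.
have t1 : t^-1 != 0 by rewrite invr_eq0 gt_eqF.
rewrite /rconv; under eq_Rintegral do rewrite ppow_conv_affine//.
rewrite RintegralZl//; last exact/integrable_affine/integrable_beta_integrand.
rewrite /euler_beta (@Rintegral_affine _ _ 0 (beta_integrand p q) t1)//; last exact: integrable_beta_integrand.
rewrite ppow_gt0// (@powRD _ t (p + q) 1); last by rewrite (gt_eqF t0) implybT.
rewrite powRr1 ?ltW// ger0_norm ?invr_ge0 ?ltW//.
have tn : t != 0 by rewrite gt_eqF.
by set I := Rintegral _ _ _; field.
Qed.

Lemma euler_beta_ge0 p q : 0 <= euler_beta p q.
Proof. by apply: Rintegral_ge0 => x _; rewrite mulr_ge0 ?ppow_ge0. Qed.

Section BoundedConvolution.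
Variables (p q M N t T : R) (u v : R -> R).
Hypotheses (p1 : -1 < p) (q1 : -1 < q) (M0 : 0 <= M) (N0 : 0 <= N).
Hypotheses (T0 : 0 < T) (tT : t <= T).
Hypotheses (mu_ : measurable_fun setT u) (mv : measurable_fun setT v).
Hypothesis uM : forall x, x <= T -> `|u x| <= M * ppow p x.
Hypothesis vN : forall x, x <= T -> `|v x| <= N * ppow q x.

Lemma conv_integrand_le x :
  `|u (t - x) * v x| <= M * N * (ppow p (t - x) * ppow q x).
Proof.
have c0 (w : R -> R) K r y : (forall x, x <= T -> `|w x| <= K * ppow r x) -> y <= 0 -> w y = 0.
  move=> wK y0; apply/normr0_eq0/le_anti.
  by rewrite normr_ge0 andbT (le_trans (wK y _)) ?ppow_le0 ?mulr0// (le_trans y0)// ltW.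
have rhs0 : 0 <= M * N * (ppow p (t - x) * ppow q x) by rewrite !mulr_ge0 ?ppow_ge0.
have [x0|x0] := leP x 0; first by rewrite (c0 _ _ _ _ vN x0) mulr0 normr0.
have [tx|xt] := leP t x.
  by rewrite (c0 _ _ _ _ uM) ?subr_le0// mul0r normr0.
rewrite normrM mulrACA ler_pM//; first by apply: uM; rewrite lerBlDr (le_trans tT)// lerDl ltW.
by apply: vN; rewrite (le_trans (ltW xt)).
Qed.

Lemma measurable_conv_integrand :
  measurable_fun setT (fun x => u (t - x) * v x).
Proof.
apply: measurable_funM => //.
by apply: (measurableT_comp mu_); exact: measurable_funB.
Qed.

Lemma bounded_integrable_conv :
  mu.-integrable setT (fun x => (u (t - x) * v x)%:E).
Proof.
have : mu.-integrable setT (fun x => (M * N)%:E * (ppow p (t - x) * ppow q x)%:E)%E.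
  by apply: integrableZl => //; exact: integrable_ppow_conv.
apply: le_integrable => //.
  by apply/measurable_EFinP; exact: measurable_conv_integrand.
move=> x _; rewrite -EFinM !abse_EFin lee_fin.
by rewrite (le_trans (conv_integrand_le x))// ler_norm.
Qed.

(** Convolution is monotone in absolute values, so powers give the general
    case. *)
Lemma bounded_rconv_le :
  `|rconv u v t| <= M * N * euler_beta p q * ppow (p + q + 1) t.
Proof.
rewrite -mulrA -rconv_ppow// /rconv.
have i1 := bounded_integrable_conv.
have i2 := integrable_ppow_conv t p1 q1.
rewrite (le_trans (le_normr_Rintegral _ _))// -RintegralZl//.
apply: le_Rintegral => //.
- exact: (integrable_norm i1).
- exact: (integrableZl measurableT (M * N) i2).
- by move=> x _; exact: conv_integrand_le.
Qed.

End BoundedConvolution.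

Lemma integrable_conv u v t : rCm1 u -> rCm1 v ->
  mu.-integrable setT (fun x => (u (t - x) * v x)%:E).
Proof.
move=> uC vC; have mu1 := rCm1_measurable uC; have mv1 := rCm1_measurable vC.
case: uC vC => [_ [p p1 pu]] [_ [q q1 qv]].
have T0 : 0 < Num.max 1 t by rewrite lt_max ltr01.
have [M M0 Mu] := pu _ T0; have [N N0 Nv] := qv _ T0.
apply: (@bounded_integrable_conv p q M N t (Num.max 1 t)) => //.
by rewrite le_max lexx orbT.
Qed.

Lemma ppow_bounded_rconv p q u v : measurable_fun setT u -> measurable_fun setT v ->
  -1 < p -> -1 < q -> ppow_bounded p u -> ppow_bounded q v -> ppow_bounded (p + q + 1) (rconv u v).
Proof.
move=> mu1 mv1 p1 q1 pu qv T T0.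
have [M M0 Mu] := pu _ T0; have [N N0 Nv] := qv _ T0.
exists (M * N * euler_beta p q); first by rewrite !mulr_ge0 ?euler_beta_ge0.
by move=> x xT; apply: (@bounded_rconv_le p q M N x T).
Qed.

(** The substitution x = t s moves t from the domain of integration into the
    integrand, where continuity in t is easier to see. *)
Lemma rconv_scaled u v t : rCm1 u -> rCm1 v -> 0 < t ->
  rconv u v t = t * \int[mu]_(s in `]0, 1[) (u (t - t * s) * v (t * s)).
Proof.
move=> uC vC t0; rewrite /rconv (Rintegral_affine 0 (lt0r_neq0 t0)); last exact: integrable_conv.
rewrite gtr0_norm// [in RHS]Rintegral_mkcond; congr (_ * _).
apply: eq_Rintegral => s _; rewrite patchE addr0.
case: ifPn => //; rewrite notin_setE/= in_itv/= => /negP; rewrite negb_and -!leNgt => /orP[s0|s1].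
  by rewrite (rCm1_causal vC) ?mulr0// mulr_ge0_le0// ltW.
rewrite (rCm1_causal uC) ?mul0r// subr_le0.
by rewrite ler_peMr// ltW.
Qed.

(** Dominated continuity for the integral of [rconv_scaled]: for t in a
    compact interval of (0,oo), the integrand is bounded by a constant times
    the Beta integrand. *)
Lemma rconv_continuous u v t : rCm1 u -> rCm1 v -> 0 < t ->
  {for t, continuous (rconv u v)}.
Proof.
move=> uC vC t0.
have mu1 := rCm1_measurable uC; have mv1 := rCm1_measurable vC.
have [cu [p p1 pu]] := uC; have [cv [q q1 qv]] := vC.
pose F (x : R) := \int[mu]_(s in `]0, 1[) (u (x - x * s) * v (x * s)).
have tI : t \in `]t / 2, t * 2[.
  by rewrite in_itv/=; apply/andP; split; lra.
have T0 : 0 < t * 2 by lra.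
have [M M0 Mu] := pu _ T0; have [N N0 Nv] := qv _ T0.
pose C := M * N * ((t / 2) `^ (p + q) + (t * 2) `^ (p + q)).
suff cF : {for t, continuous F}.
  have : {for t, continuous (fun x => x * F x)} by apply: continuousM.
  rewrite /prop_for /continuous_at -rconv_scaled// => cG; apply: cvg_trans cG.
  apply: near_eq_cvg; near=> x; apply/esym/rconv_scaled => //.
  by near: x; exact: lt_nbhsr.
apply: (@continuity_under_integral _ _ _ mu (fun x s => u (x - x * s) * v (x * s))
   `]0, 1[ _ (t / 2) (t * 2) _ _ (fun s => C * beta_integrand p q s)).
- by [].
- move=> x /=; rewrite in_itv/= => /andP[tx _].
  have x0 : 0 < x by lra.
  apply: (@integrableS _ _ _ _ setT) => //.
  have := integrable_affine 0 (lt0r_neq0 x0) (integrable_conv x uC vC).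
  by under eq_fun do rewrite addr0.
- apply: nearW => s /=; rewrite in_itv/= => /andP[s0 s1] x.
  rewrite inE/= in_itv/= => /andP[tx _]; have x0 : 0 < x by lra.
  have c1 : {for x, continuous (fun y : R => y - y * s)}.
    by apply: continuousB => //; apply: continuousM => //; exact: cst_continuous.
  have c2 : {for x, continuous (fun y : R => y * s)}.
    by apply: continuousM => //; exact: cst_continuous.
  apply: continuousM.
    apply: (continuous_comp c1); apply: cu.
    by rewrite subr_gt0 gtr_pMr.
  by apply: (continuous_comp c2); apply: cv; rewrite mulr_gt0.
- apply: (@integrableS _ _ _ _ setT) => //.
  exact: (integrableZl measurableT C (integrable_beta_integrand p1 q1)).
- move=> x /=; rewrite in_itv/= => /andP[tx xt]; have x0 : 0 < x by lra.
  apply: nearW => s /=; rewrite in_itv/= => /andP[s0 s1].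
  rewrite (le_trans (conv_integrand_le M0 N0 T0 (ltW xt) Mu Nv _))//.
  rewrite ppow_conv_affine// addr0 mulKf ?gt_eqF// /C -!mulrA.
  do 2 apply: ler_wpM2l => //.
  rewrite ler_wpM2r ?mulr_ge0 ?ppow_ge0// powR_le_ends//; first lra.
  by rewrite !ltW.
- by rewrite inE.
Unshelve. all: by end_near. Qed.

Lemma rCm1_conv u v : rCm1 u -> rCm1 v -> rCm1 (rconv u v).
Proof.
move=> uC vC; split=> [x x0|]; first exact: rconv_continuous.
have mu1 := rCm1_measurable uC; have mv1 := rCm1_measurable vC.
case: uC vC => [_ [p p1 pu]] [_ [q q1 qv]].
exists (p + q + 1); first by lra.
exact: ppow_bounded_rconv.
Qed.

Lemma rconvC u v : rCm1 u -> rCm1 v -> rconv u v = rconv v u.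
Proof.
move=> uC vC; apply/funext => t; rewrite /rconv.
have n1 : -1 != 0 :> R by rewrite oppr_eq0 oner_eq0.
rewrite (Rintegral_affine t n1); last exact: integrable_conv.
rewrite normrN1 mul1r; apply: eq_Rintegral => x _.
by rewrite mulN1r opprD opprK addrCA subrr addr0 addrC mulrC.
Qed.

Lemma rconvDl u1 uemb v : rCm1 u1 -> rCm1 uemb -> rCm1 v ->
  rconv (fun x => u1 x + uemb x) v = fun t => rconv u1 v t + rconv uemb v t.
Proof.
move=> C1 C2 vC; apply/funext => t; rewrite /rconv.
under eq_Rintegral do rewrite mulrDl.
by rewrite RintegralD//; exact: integrable_conv.
Qed.

Lemma rconvZl a u v : rCm1 u -> rCm1 v ->
  rconv (fun x => a * u x) v = fun t => a * rconv u v t.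
Proof.
move=> uC vC; apply/funext => t; rewrite /rconv.
under eq_Rintegral do rewrite -mulrA.
by rewrite RintegralZl//; exact: integrable_conv.
Qed.

(** Fubini for u(t - s) v(s - x) w(x). Integrability over the plane is
    Tonelli for the absolute values: the inner integral is the convolution
    of |v| and |w|, which is again of class C_{-1}, hence convolvable with
    |u|. *)
Lemma rconvA u v w : rCm1 u -> rCm1 v -> rCm1 w ->
  rconv u (rconv v w) = rconv (rconv u v) w.
Proof.
move=> uC vC wC; apply/funext => t.
pose f (z : R * R) : \bar R := (u (t - z.1) * (v (z.1 - z.2) * w z.2))%:E.
have mf : measurable_fun setT f.
  apply/measurable_EFinP; apply: measurable_funM.
    apply: (measurableT_comp (rCm1_measurable uC)).
    by apply: measurable_funB => //; exact: measurable_fst.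
  apply: measurable_funM; last exact: (measurableT_comp (rCm1_measurable wC)).
  apply: (measurableT_comp (rCm1_measurable vC)); exact: measurable_funB.
have fi : (mu \x mu)%E.-integrable setT f.
  apply/(integrable12ltyP _ _ _).2 => //.
  have [_] := integrableP _ _ _ (integrable_conv t (rCm1_norm uC)
    (rCm1_conv (rCm1_norm vC) (rCm1_norm wC))).
  apply: le_lt_trans; rewrite le_eqVlt; apply/orP; left; apply/eqP.
  apply: eq_integral => s _.
  rewrite gee0_abs ?lee_fin; last first.
    rewrite mulr_ge0// Rintegral_ge0// => x _; exact: mulr_ge0.
  have iv := integrable_conv s (rCm1_norm vC) (rCm1_norm wC).
  rewrite /rconv -RintegralZl// /Rintegral fineK; last first.
    apply: integrable_fin_num => //; exact: (integrableZl measurableT `|u (t - s)| iv).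
  by apply: eq_integral => x _; rewrite /f/= !normrM.
(* The two iterated integrals are the two sides, up to the translation x - s
   in the second one. *)
have := Fubini fi.
under eq_integral => s _.
  rewrite (_ : integral _ _ _ = (u (t - s) * rconv v w s)%:E); last first.
    have iv := integrable_conv s vC wC.
    rewrite /rconv -RintegralZl// /Rintegral fineK//.
    by apply: integrable_fin_num => //; exact: (integrableZl measurableT (u (t - s)) iv).
  over.
under [in X in _ = X]eq_integral => s _.
  rewrite (_ : integral _ _ _ = (rconv u v (t - s) * w s)%:E); last first.
    have iu := integrable_conv (t - s) uC vC.
    have i2 : mu.-integrable setT (EFin \o (fun x => u (t - x) * v (x - s))).
      have := integrable_affine (- s) (oner_neq0 R) iu.
      apply: eq_integrable => // x _ /=.
      by rewrite mul1r opprB addrA subrK.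
    have -> : rconv u v (t - s) = \int[mu]_x (u (t - x) * v (x - s)).
      rewrite (Rintegral_affine s (oner_neq0 R) i2) normr1 mul1r.
      by apply: eq_Rintegral => x _; rewrite mul1r addrK opprD addrA addrAC.
    rewrite /Rintegral.
    transitivity (\int[mu]_x ((u (t - x) * v (x - s))%:E * (w s)%:E))%E.
      by apply: eq_integral => x _; rewrite /f/= -EFinM mulrA.
    rewrite integralZr// EFinM fineK//; exact: integrable_fin_num.
  over.
by move=> H; rewrite /rconv /Rintegral H.
Qed.

End RealConvolution.

(** * Primitives, weighted estimates and series *)

Section RealCalculus.
Variable R : realType.
Notation mu := (@lebesgue_measure R).
Implicit Types (p q r t x : R) (u v w : R -> R).

Lemma rCm1_ppow p : -1 < p -> rCm1 (ppow p : R -> R).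
Proof.
move=> p1; split=> [x x0|]; last first.
  by exists p => // T T0; exists 1 => // x _; rewrite mul1r ger0_norm// ppow_ge0.
have := continuous_powR (p := p) x0; rewrite /prop_for /continuous_at -(ppow_gt0 p x0) => cG.
apply: cvg_trans cG.
apply: near_eq_cvg; near=> y; rewrite ppow_gt0//.
by near: y; exact: lt_nbhsr.
Unshelve. all: by end_near. Qed.

(** Convolution with the Heaviside function is the primitive that vanishes
    at 0. *)
Lemma is_derive_rconv1 u t : rCm1 u -> 0 < t ->
  is_derive t 1 (rconv (ppow 0) u) (u t).
Proof.
move=> uC t0; have p0 : rCm1 (ppow 0 : R -> R) by apply: rCm1_ppow.
have int_u (y : R) : mu.-integrable `]-oo, y]%classic (EFin \o u).
  have H := integrable_conv (y + 1) p0 uC.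
  have : mu.-integrable `]-oo, y]%classic (fun x => (ppow 0 (y + 1 - x) * u x)%:E).
    by apply: (@integrableS _ _ _ _ setT).
  apply: eq_integrable => // x; rewrite inE/= in_itv/= => xy.
  by rewrite ppow_gt0 ?powRr0 ?mul1r// subr_gt0 (le_lt_trans xy)// ltrDl.
have -> : rconv (ppow 0) u = fun y : R => \int[mu]_(x in `]-oo, y]) u x.
  apply/funext => y; rewrite -Rintegral_itv_bndo_bndc; last first.
    apply: integrableS (int_u y) => //; apply: subset_itvl; by rewrite bnd_simp.
  rewrite Rintegral_mkcond /rconv; apply: eq_Rintegral => x _; rewrite patchE.
  case: ifPn; rewrite ?(inE, notin_setE)/= in_itv/= => xy.
    by rewrite ppow_gt0 ?powRr0 ?mul1r// subr_gt0.
  by rewrite ppow_le0 ?mul0r// subr_le0 leNgt; apply/negP.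
have tt : t < t + 1 by rewrite ltrDl.
have [|d1 d2] := continuous_FTC1 tt (int_u (t + 1)) _ (uC.1 t t0).
  exact: ltNyr.
by split; [exact: d1|rewrite -derive1E].
Qed.

(** The constant B in 1 * t^n = B t^(n+1) is found by differentiating both
    sides at t = 1. *)
Lemma euler_beta0n (n : nat) : euler_beta 0 n%:R = n.+1%:R^-1 :> R.
Proof.
have n1 : -1 < n%:R :> R by rewrite (lt_le_trans _ (ler0n _ _))// ltrN10.
have [d e] := is_derive_rconv1 (rCm1_ppow n1) (@ltr01 R).
have : is_derive (1:R) 1 (rconv (ppow 0) (ppow n%:R)) (euler_beta 0 n%:R * n.+1%:R).
  apply: (@near_eq_is_derive _ _ _ (fun y : R => euler_beta 0 n%:R * y `^ (n.+1%:R))).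
  - near=> y. rewrite rconv_ppow// ?ltrN10// add0r ppow_gt0 ?natr1//.
    by near: y; exact: lt_nbhsr.
  - have := is_deriveZ (euler_beta 0 n%:R : R) (is_derive1_powR n.+1%:R (@ltr01 R)).
    by rewrite powR1 mulr1.
move=> [_]; rewrite e ppow_gt0// powR1 => H.
by rewrite -[LHS](mulfK (_ : n.+1%:R != 0 :> R)) ?pnatr_eq0// -H mul1r.
Unshelve. all: by end_near. Qed.

Lemma rconv1_ppow (n : nat) t :
  rconv (ppow 0) (ppow n%:R) t = n.+1%:R^-1 * ppow n.+1%:R t :> R.
Proof.
rewrite rconv_ppow ?euler_beta0n ?add0r ?natr1 ?ltrN10//.
by rewrite (lt_le_trans _ (ler0n _ _))// ltrN10.
Qed.

(** Since e^x >= 1 + x >= x^b for 0 <= b <= 1. *)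
Lemma expRN_le_powR b x : 0 <= b <= 1 -> 0 < x -> expR (- x) <= x `^ (- b).
Proof.
move=> /andP[b0 b1] x0; rewrite expRN powRN lef_pV2 ?posrE ?expR_gt0 ?powR_gt0//.
apply: le_trans (expR_ge1Dx x).
have [x1|x1] := leP x 1.
  apply: (@le_trans _ _ (1 `^ b)); last by rewrite powR1 lerDl ltW.
  by apply: ge0_ler_powR; rewrite ?nnegrE// ltW.
by rewrite -[leLHS]add0r lerD// -[leRHS](powRr1 (ltW x0)) ler_powR// ltW.
Qed.

(** Multiplication by e^(-st) is an endomorphism of the convolution algebra,
    because t = (t - x) + x. *)
Lemma rconv_weighted s u v t : rconv (fun x => expR (- (s * x)) * u x)
    (fun x => expR (- (s * x)) * v x) t =
  \int[mu]_x (expR (- (s * t)) * (u (t - x) * v x)).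
Proof.
apply: eq_Rintegral => x _.
rewrite mulrACA -expRD; congr (expR _ * _); ring.
Qed.

(** The factor s^(-b) makes convolution with u a contraction for large s, in
    the norm sup e^(-sx) x^(-p) |v(x)| on (0,T]. It is obtained by passing
    to the weighted functions and trading the decay e^(-sx) of the weighted
    u for (s x)^(-b): this costs the part b of the exponent p of u, which is
    affordable as long as p - b > -1. *)
Lemma rconv_weighted_le p b s M N T u v t : -1 < p - b -> 0 < b <= 1 ->
  0 < s -> 0 <= M -> 0 <= N -> 0 < T -> t <= T -> rCm1 u -> rCm1 v ->
  (forall x, x <= T -> `|u x| <= M * ppow p x) ->
  (forall x, x <= T -> `|v x| <= N * (expR (s * x) * ppow p x)) ->
  `|rconv u v t| <= N * (M * (s `^ (- b) * euler_beta (p - b) p * T `^ (p - b + 1))) *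
     (expR (s * t) * ppow p t).
Proof.
move=> pb /andP[b0 b1] s0 M0 N0 T0 tT uC vC uM vN.
have p1 : -1 < p by lra.
have mu1 := rCm1_measurable uC; have mv1 := rCm1_measurable vC.
have me : measurable_fun setT (fun x => expR (- (s * x)) : R).
  apply: measurableT_comp => //; apply: measurableT_comp => //; exact: mulrl_measurable.
have uM' x : x <= T -> `|expR (- (s * x)) * u x| <= (M * s `^ (- b)) * ppow (p - b) x.
  move=> xT; have [x0|x0] := leP x 0.
    by rewrite (rCm1_causal uC)// mulr0 normr0 ppow_le0// mulr0.
  rewrite normrM ger0_norm ?expR_ge0//.
  apply: (@le_trans _ _ ((s * x) `^ (- b) * (M * ppow p x))).
    by rewrite ler_pM ?expR_ge0 ?uM// expRN_le_powR ?mulr_gt0// b1 ltW.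
  rewrite powRM ?(ltW s0) ?(ltW x0)// !ppow_gt0// powRD; last by rewrite (gt_eqF x0) implybT.
  by rewrite le_eqVlt; apply/orP; left; apply/eqP; ring.
have vN' x : x <= T -> `|expR (- (s * x)) * v x| <= N * ppow p x.
  move=> xT; rewrite normrM ger0_norm ?expR_ge0// expRN mulrC ler_pdivrMr ?expR_gt0//.
  by rewrite -mulrA [ppow p x * _]mulrC vN.
have Ms : 0 <= M * s `^ (- b) by rewrite mulr_ge0 ?powR_ge0.
have := bounded_rconv_le pb p1 Ms N0 T0 tT (measurable_funM me mu1)
  (measurable_funM me mv1) uM' vN'.
rewrite rconv_weighted RintegralZl//; last exact: integrable_conv.
rewrite normrM ger0_norm ?expR_ge0// expRN mulrC ler_pdivrMr ?expR_gt0// => /le_trans; apply.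
have := @ppow_weaken _ (p - b + p + 1) p t T _ tT T0.
rewrite (_ : p - b + p + 1 - p = p - b + 1); last by ring.
set X := ppow _ t => H.
have {}H : X <= T `^ (p - b + 1) * ppow p t by apply: H; lra.
pose K := N * M * s `^ (- b) * euler_beta (p - b) p * expR (s * t).
have K0 : 0 <= K by rewrite !mulr_ge0 ?powR_ge0 ?euler_beta_ge0 ?expR_ge0.
rewrite [leLHS](_ : _ = K * X); last by rewrite /K; ring.
apply: (le_trans (ler_wpM2l K0 H)).
by rewrite le_eqVlt; apply/orP; left; apply/eqP; rewrite /K; ring.
Qed.

Lemma geometric_series_bound (f : nat -> R) K : 0 <= K ->
  (forall j, `|f j| <= K * 2^-1 ^+ j) ->
  cvgn (series f) /\
  forall N, `|limn (series f) - series f N| <= K * 2 * 2^-1 ^+ N.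
Proof.
move=> K0 fK.
have cf : cvgn (series f).
  apply: normed_cvg; apply: (@series_le_cvg _ _ (geometric K 2^-1)) => //.
  - by move=> n; exact: normr_ge0.
  - by move=> n; rewrite /geometric/= mulr_ge0// exprn_ge0.
  - by apply: is_cvg_geometric_series; rewrite ger0_norm//; lra.
split=> // N.
have fin (n : nat) : `|series f (N + n)%N - series f N| <= K * 2 * 2^-1 ^+ N.
  apply: (@le_trans _ _ (K * 2 * (2^-1 ^+ N - 2^-1 ^+ (N + n)))); last first.
    by rewrite ler_wpM2l ?mulr_ge0// gerBl exprn_ge0.
  elim: n => [|n IH].
    by rewrite addn0 !subrr mulr0 normr0.
  rewrite addnS /series/= big_nat_recr//= addrAC.
  apply: (le_trans (ler_normD _ _)); apply: (le_trans (lerD IH (fK _))).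
  by rewrite exprS le_eqVlt; apply/orP; left; apply/eqP; field.
have : (fun n => `|series f (N + n)%N - series f N|) @ \oo --> `|limn (series f) - series f N|.
  apply: cvg_norm; apply: cvgB; last exact: cvg_cst.
  have -> : (fun n => series f (N + n)%N) = [sequence series f (n + N)%N]_n.
    by apply/funext => n; rewrite /= addnC.
  by rewrite (cvg_shiftn N (series f)).
move=> cv; have <- := cvg_lim (@Rhausdorff R) cv.
by apply: limr_le; [exact: (cvgP _ cv)|exact: nearW].
Qed.

Lemma rCm1_sum (f : nat -> R -> R) n : (forall j, rCm1 (f j)) ->
  rCm1 (fun x => series (f^~ x) n).
Proof.
move=> fC; elim: n => [|n IH].
  by under eq_fun do rewrite /series/= big_nil; exact: rCm1_0.
by under eq_fun do rewrite /series/= big_nat_recr//=; exact: rCm1D.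
Qed.

(** Divided by t^p, the series converges uniformly on each (0,T]; so its sum
    inherits both the bound and the continuity for t > 0. *)
Lemma rCm1_series p (f : nat -> R -> R) : -1 < p -> (forall j, rCm1 (f j)) ->
  (forall T, 0 < T -> exists2 K, 0 <= K &
     forall j x, x <= T -> `|f j x| <= K * 2^-1 ^+ j * ppow p x) ->
  let F x := limn (series (f^~ x)) in
  [/\ rCm1 F, forall x, cvgn (series (f^~ x)) &
   forall T, 0 < T -> exists2 K, 0 <= K &
     forall n x, x <= T -> `|F x - series (f^~ x) n| <= K * 2^-1 ^+ n * ppow p x].
Proof.
move=> p1 fC fK F.
have H T : 0 < T -> exists2 K, 0 <= K & forall x, x <= T ->
    cvgn (series (f^~ x)) /\
    forall n, `|F x - series (f^~ x) n| <= K * 2^-1 ^+ n * ppow p x.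
  move=> T0; have [K K0 fKT] := fK _ T0; exists (K * 2); first exact: mulr_ge0.
  move=> x xT; have Kp : 0 <= K * ppow p x by rewrite mulr_ge0// ppow_ge0.
  have [|c b] := @geometric_series_bound (f^~ x) _ Kp.
    by move=> j; rewrite mulrAC fKT.
  split=> // n; apply: (le_trans (b n)).
  by rewrite le_eqVlt; apply/orP; left; apply/eqP; ring.
have cF x : cvgn (series (f^~ x)).
  have T0 : 0 < Num.max 1 x by rewrite lt_max ltr01.
  by have [K _ /(_ x)[]//] := H _ T0; rewrite le_max lexx orbT.
have rF T : 0 < T -> exists2 K, 0 <= K &
     forall n x, x <= T -> `|F x - series (f^~ x) n| <= K * 2^-1 ^+ n * ppow p x.
  by move=> T0; have [K K0 HK] := H T T0; exists K => // n x xT; apply: (HK x xT).2.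
split=> //; split; last first.
  exists p => // T T0; have [K K0 HK] := rF T T0; exists K => // x xT.
  by have := HK 0%N x xT; rewrite /series/= big_nil subr0 expr0 mulr1.
move=> x x0; have T0 : 0 < x * 2 by rewrite mulr_gt0.
have [K K0 HK] := rF _ T0.
pose B := (x / 2) `^ p + (x * 2) `^ p.
apply/cvgrPdist_lt => e e0.
have /cvgrPdist_lt/(_ _ (divr_gt0 e0 (ltr0n R 3)))[N _ /(_ N (leqnn N))] :
    (fun n => K * B * 2^-1 ^+ n) @ \oo --> (0:R).
  rewrite -(mulr0 (K * B)); apply: cvgMr; apply: cvg_expr.
  by rewrite ger0_norm//; lra.
rewrite /= sub0r normrN ger0_norm; last by rewrite !mulr_ge0 ?addr_ge0 ?powR_ge0 ?exprn_ge0.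
move=> KB.
have near_le y : x / 2 <= y <= x * 2 -> `|F y - series (f^~ y) N| < e / 3%:R.
  move=> /andP[y1 y2]; have y0 : 0 < y by rewrite (lt_le_trans _ y1)// divr_gt0.
  apply: le_lt_trans (HK N y y2) _; apply: le_lt_trans KB.
  rewrite mulrAC ler_wpM2r ?exprn_ge0// ler_wpM2l// ppow_gt0//.
  by apply: powR_le_ends; rewrite ?divr_gt0// y1.
have cS : {for x, continuous (fun y => series (f^~ y) N)} by apply: (rCm1_sum N fC).1.
move/cvgrPdist_lt : cS => /(_ _ (divr_gt0 e0 (ltr0n R 3))) cS.
have x2 : x / 2 < x by lra.
have x3 : x < x * 2 by lra.
near=> y.
rewrite (_ : F x - F y = (F x - series (f^~ x) N) + (series (f^~ x) N - series (f^~ y) N)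
   + - (F y - series (f^~ y) N)); last by ring.
have -> : e = e / 3%:R + e / 3%:R + e / 3%:R by field.
apply: (le_lt_trans (ler_normD _ _)); apply: ltrD; last first.
  rewrite normrN near_le//; apply/andP; split.
    by apply: ltW; near: y; exact: lt_nbhsr.
  by apply: ltW; near: y; exact: lt_nbhsl.
apply: (le_lt_trans (ler_normD _ _)); apply: ltrD.
  by apply: near_le; rewrite !ltW.
by near: y.
Unshelve. all: by end_near. Qed.

End RealCalculus.

(** * Convolution of causal complex functions *)

Section ComplexFunctions.
Variable R : realType.
Notation mu := (@lebesgue_measure R).
Notation C := R[i].
Notation Re := (@complex.Re R).
Notation Im := (@complex.Im R).
Implicit Types (f g h : R -> C) (t x : R).
Local Open Scope complex_scope.

Definition causal f : R -> C := fun t => if 0 < t then f t else 0.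

Definition cCm1 f : Prop :=
  rCm1 (fun x => Re (f x)) /\ rCm1 (fun x => Im (f x)).

Lemma complex_inj (z w : C) : Re z = Re w -> Im z = Im w -> z = w.
Proof. by case: z w => [a b] [c d] /= -> ->. Qed.

Lemma cReM (z w : C) : Re (z * w) = Re z * Re w - Im z * Im w.
Proof. by case: z w => [a b] [c d]. Qed.

Lemma cImM (z w : C) : Im (z * w) = Re z * Im w + Im z * Re w.
Proof. by case: z w => [a b] [c d]. Qed.

Lemma cReD (z w : C) : Re (z + w) = Re z + Re w.
Proof. by case: z w => [a b] [c d]. Qed.

Lemma cImD (z w : C) : Im (z + w) = Im z + Im w.
Proof. by case: z w => [a b] [c d]. Qed.

Lemma cCm1_causal f x : cCm1 f -> x <= 0 -> f x = 0.
Proof.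
by move=> [fr fi] x0; apply: complex_inj; [exact: (rCm1_causal fr)|exact: (rCm1_causal fi)].
Qed.

(** The values for t <= 0 are never used: this is what allows a function on
    (0,oo) to be replaced by any of its extensions. *)
Lemma eq_lconv f f' g g' : (forall t, 0 < t -> f t = f' t) ->
  (forall t, 0 < t -> g t = g' t) -> lconv f g = lconv f' g'.
Proof.
move=> ff gg; apply/funext => t; rewrite /lconv /cintegral.
by congr (_ +i* _); apply: eq_Rintegral => x; rewrite inE/= in_itv/= => /andP[x0 xt];
  rewrite gg// ff// subr_gt0.
Qed.

Lemma causalE f t : 0 < t -> causal f t = f t.
Proof. by rewrite /causal => ->. Qed.

Lemma lconv_causal f g : lconv (causal f) (causal g) = lconv f g.
Proof. by apply: eq_lconv => t t0; rewrite causalE. Qed.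

Lemma lconv_causall f g : lconv (causal f) g = lconv f g.
Proof. by apply: eq_lconv => t t0; rewrite ?causalE. Qed.

Lemma rconv_itv u v t : rCm1 u -> rCm1 v ->
  \int[mu]_(x in `]0, t[) (u (t - x) * v x) = rconv u v t :> R.
Proof.
move=> uC vC; rewrite Rintegral_mkcond; apply: eq_Rintegral => x _.
rewrite patchE; case: ifPn => //; rewrite notin_setE/= in_itv/= => /negP.
rewrite negb_and -!leNgt => /orP[x0|tx].
  by rewrite (rCm1_causal vC)// mulr0.
by rewrite (rCm1_causal uC) ?mul0r// subr_le0.
Qed.

Lemma integrable_conv_itv (u v : R -> R) t : rCm1 u -> rCm1 v ->
  mu.-integrable `]0, t[ (EFin \o (fun x => u (t - x) * v x)).
Proof.
move=> uC vC; have H := integrable_conv t uC vC.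
by apply: (@integrableS _ _ _ _ setT).
Qed.

Lemma Re_lconv f g t : cCm1 f -> cCm1 g -> Re (lconv f g t) =
  rconv (fun x => Re (f x)) (fun x => Re (g x)) t -
  rconv (fun x => Im (f x)) (fun x => Im (g x)) t.
Proof.
move=> [fr fi] [gr gi]; rewrite /lconv /cintegral/=.
under eq_Rintegral do rewrite cReM.
rewrite RintegralB//; last 2 first.
- exact: (integrable_conv_itv t fr gr).
- exact: (integrable_conv_itv t fi gi).
by congr (_ - _); exact: rconv_itv.
Qed.

Lemma Im_lconv f g t : cCm1 f -> cCm1 g -> Im (lconv f g t) =
  rconv (fun x => Re (f x)) (fun x => Im (g x)) t +
  rconv (fun x => Im (f x)) (fun x => Re (g x)) t.
Proof.
move=> [fr fi] [gr gi]; rewrite /lconv /cintegral/=.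
under eq_Rintegral do rewrite cImM.
rewrite RintegralD//; last 2 first.
- exact: (integrable_conv_itv t fr gi).
- exact: (integrable_conv_itv t fi gr).
by congr (_ + _); exact: rconv_itv.
Qed.

Lemma rCm1N (u : R -> R) : rCm1 u -> rCm1 (fun x => - u x).
Proof. by move=> uC; under eq_fun do rewrite -mulN1r; exact: rCm1Z. Qed.

Lemma rCm1B (u v : R -> R) : rCm1 u -> rCm1 v -> rCm1 (fun x => u x - v x).
Proof. by move=> uC vC; apply: rCm1D => //; exact: rCm1N. Qed.

Lemma cCm1_lconv f g : cCm1 f -> cCm1 g -> cCm1 (lconv f g).
Proof.
move=> fC gC; split.
  under eq_fun do rewrite Re_lconv//.
  by case: fC gC => [fr fi] [gr gi]; apply: rCm1B; exact: rCm1_conv.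
under eq_fun do rewrite Im_lconv//.
by case: fC gC => [fr fi] [gr gi]; apply: rCm1D; exact: rCm1_conv.
Qed.

Lemma cCm1D f g : cCm1 f -> cCm1 g -> cCm1 (f + g).
Proof.
move=> [fr fi] [gr gi]; split.
  by under eq_fun do rewrite cReD; exact: rCm1D.
by under eq_fun do rewrite cImD; exact: rCm1D.
Qed.

Lemma cCm1Z (a : C) f : cCm1 f -> cCm1 (fun x => a * f x).
Proof.
move=> [fr fi]; split.
  by under eq_fun do rewrite cReM; apply: rCm1B; exact: rCm1Z.
by under eq_fun do rewrite cImM; apply: rCm1D; exact: rCm1Z.
Qed.

Lemma cCm1N f : cCm1 f -> cCm1 (- f).
Proof.
move=> fC; have -> : - f = fun x => -1 * f x by apply/funext => x; rewrite mulN1r.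
exact: cCm1Z.
Qed.

Lemma cCm1_0 : cCm1 0.
Proof. by split; exact: rCm1_0. Qed.

Lemma lconvC f g : cCm1 f -> cCm1 g -> lconv f g = lconv g f.
Proof.
move=> fC gC; apply/funext => t; have [fr fi] := fC; have [gr gi] := gC.
apply: complex_inj; rewrite ?(Re_lconv _ fC gC) ?(Re_lconv _ gC fC)
  ?(Im_lconv _ fC gC) ?(Im_lconv _ gC fC).
  by congr (_ - _); rewrite rconvC.
by rewrite addrC; congr (_ + _); rewrite rconvC.
Qed.

Lemma lconvDl f g h : cCm1 f -> cCm1 g -> cCm1 h ->
  lconv (f + g) h = lconv f h + lconv g h.
Proof.
move=> fC gC hC; have fgC := cCm1D fC gC; apply/funext => t.
case: (fC) (gC) (hC) => [fr fi] [gr gi] [hr hi].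
have Er : (fun x => Re ((f + g) x)) = fun x => Re (f x) + Re (g x).
  by apply/funext => x; exact: cReD.
have Ei : (fun x => Im ((f + g) x)) = fun x => Im (f x) + Im (g x).
  by apply/funext => x; exact: cImD.
rewrite fctE; apply: complex_inj; rewrite ?cReD ?cImD ?Re_lconv// ?Im_lconv//.
  by rewrite Er Ei !rconvDl//; ring.
by rewrite Er Ei !rconvDl//; ring.
Qed.

Lemma rconvBl (u1 uemb v : R -> R) : rCm1 u1 -> rCm1 uemb -> rCm1 v ->
  rconv (fun x => u1 x - uemb x) v = fun t => rconv u1 v t - rconv uemb v t.
Proof.
move=> C1 C2 vC; apply/funext => t.
have := rconvDl C1 (rCm1Z (-1) C2) vC; rewrite rconvZl// => /(congr1 (@^~ t)).
rewrite mulN1r => <-; congr (rconv _ _ t); apply/funext => x; by rewrite mulN1r.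
Qed.

Lemma lconvZl (a : C) f g : cCm1 f -> cCm1 g ->
  lconv (fun x => a * f x) g = fun t => a * lconv f g t.
Proof.
move=> fC gC; have aC := cCm1Z a fC; apply/funext => t.
case: (fC) (gC) => [fr fi] [gr gi].
have Er : (fun x => Re (a * f x)) = fun x => Re a * Re (f x) - Im a * Im (f x).
  by apply/funext => x; exact: cReM.
have Ei : (fun x => Im (a * f x)) = fun x => Re a * Im (f x) + Im a * Re (f x).
  by apply/funext => x; exact: cImM.
have Z b u : rCm1 u -> rCm1 (fun x => b * u x) by exact: rCm1Z.
apply: complex_inj; rewrite ?cReM ?cImM ?Re_lconv// ?Im_lconv//.
  rewrite Er Ei !rconvBl// ?rconvDl//; do ?exact: Z.
  by rewrite !rconvZl//; ring.
rewrite Er Ei !rconvBl// ?rconvDl//; do ?exact: Z.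
by rewrite !rconvZl//; ring.
Qed.

Lemma rconvDr (u v1 v2 : R -> R) : rCm1 u -> rCm1 v1 -> rCm1 v2 ->
  rconv u (fun x => v1 x + v2 x) = fun t => rconv u v1 t + rconv u v2 t.
Proof.
move=> uC C1 C2; rewrite rconvC//; last exact: rCm1D.
by rewrite rconvDl//; apply/funext => t; rewrite !(@rconvC _ u).
Qed.

Lemma rconvBr (u v1 v2 : R -> R) : rCm1 u -> rCm1 v1 -> rCm1 v2 ->
  rconv u (fun x => v1 x - v2 x) = fun t => rconv u v1 t - rconv u v2 t.
Proof.
move=> uC C1 C2; rewrite rconvC//; last exact: rCm1B.
by rewrite rconvBl//; apply/funext => t; rewrite !(@rconvC _ u).
Qed.

Lemma lconvA f g h : cCm1 f -> cCm1 g -> cCm1 h ->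
  lconv f (lconv g h) = lconv (lconv f g) h.
Proof.
move=> fC gC hC; have ghC := cCm1_lconv gC hC; have fgC := cCm1_lconv fC gC.
apply/funext => t; case: (fC) (gC) (hC) => [fr fi] [gr gi] [hr hi].
have cv u v : rCm1 u -> rCm1 v -> rCm1 (@rconv R u v) by exact: rCm1_conv.
have Er f' g' : cCm1 f' -> cCm1 g' -> (fun x => Re (lconv f' g' x)) = fun t =>
    rconv (fun x => Re (f' x)) (fun x => Re (g' x)) t -
    rconv (fun x => Im (f' x)) (fun x => Im (g' x)) t.
  by move=> *; apply/funext => x; exact: Re_lconv.
have Ei f' g' : cCm1 f' -> cCm1 g' -> (fun x => Im (lconv f' g' x)) = fun t =>
    rconv (fun x => Re (f' x)) (fun x => Im (g' x)) t +
    rconv (fun x => Im (f' x)) (fun x => Re (g' x)) t.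
  by move=> *; apply/funext => x; exact: Im_lconv.
apply: complex_inj.
  rewrite (Re_lconv t fC ghC) (Re_lconv t fgC hC) !Er// !Ei//.
  rewrite rconvBr ?rconvDr ?rconvBl ?rconvDl//; do ?exact: cv.
  rewrite !rconvA//.
  repeat match goal with |- context [@rconv R ?u ?v t] => move: (@rconv R u v t) => ? end.
  by ring.
rewrite (Im_lconv t fC ghC) (Im_lconv t fgC hC) !Er// !Ei//.
rewrite rconvBr ?rconvDr ?rconvBl ?rconvDl//; do ?exact: cv.
rewrite !rconvA//.
repeat match goal with |- context [@rconv R ?u ?v t] => move: (@rconv R u v t) => ? end.
by ring.
Qed.

End ComplexFunctions.

(** * The convolution algebra and its unitization *)

Section CausalAlgebra.
Variable R : realType.
Notation C := R[i].

(** The predicate on functions is bundled into a type below, in order to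
    view the class C_{-1} as a module with a product. *)
Definition causalCm1 : {pred (R -> C)} := fun f => `[< cCm1 f >].

Lemma causalCm1P f : reflect (cCm1 f) (f \in causalCm1).
Proof. exact: asboolP. Qed.

Lemma causalCm1_zmod : zmod_closed causalCm1.
Proof.
split=> [|f g /causalCm1P fC /causalCm1P gC]; apply/causalCm1P.
  exact: cCm1_0.
by apply: cCm1D => //; exact: cCm1N.
Qed.

HB.instance Definition _ :=
  GRing.isZmodClosed.Build (R -> C) causalCm1 causalCm1_zmod.

Record cfun := CFun { cval :> R -> C; cvalP : cval \in causalCm1 }.
HB.instance Definition _ := [isSub for cval].
HB.instance Definition _ := [Choice of cfun by <:].
HB.instance Definition _ := [SubChoice_isSubZmodule of cfun by <:].

Implicit Types (f g h : cfun) (a b : C).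

Lemma cvalC f : cCm1 f. Proof. exact/causalCm1P/cvalP. Qed.

Definition cfun_of F (H : cCm1 F) : cfun := CFun (introT (causalCm1P F) H).

Lemma cfunP f g : (forall t, f t = g t) -> f = g.
Proof. by move=> fg; apply: val_inj; apply/funext. Qed.

Definition cconv f g : cfun := cfun_of (cCm1_lconv (cvalC f) (cvalC g)).
Definition cscale a f : cfun := cfun_of (cCm1Z a (cvalC f)).

Lemma cfunDE f g t : (f + g) t = f t + g t. Proof. by []. Qed.

Lemma cscaleA a b f : cscale a (cscale b f) = cscale (a * b) f.
Proof. by apply: cfunP => t /=; rewrite mulrA. Qed.
Lemma cscale1 : left_id 1 cscale.
Proof. by move=> f; apply: cfunP => t /=; rewrite mul1r. Qed.
Lemma cscaleDr : right_distributive cscale +%R.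
Proof. by move=> a f g; apply: cfunP => t; exact: mulrDr. Qed.
Lemma cscaleDl f : {morph cscale^~ f : a b / a + b}.
Proof. by move=> a b; apply: cfunP => t; exact: mulrDl. Qed.

HB.instance Definition _ := GRing.Zmodule_isLmodule.Build C cfun
  cscaleA cscale1 cscaleDr cscaleDl.

Lemma cfunZE a f t : (a *: f) t = a * f t. Proof. by []. Qed.

Lemma cconvA : associative cconv.
Proof. by move=> f g h; apply: val_inj; apply: lconvA; exact: cvalC. Qed.
Lemma cconvC : commutative cconv.
Proof. by move=> f g; apply: val_inj; apply: lconvC; exact: cvalC. Qed.
Lemma cconvDl : left_distributive cconv +%R.
Proof. by move=> f g h; apply: val_inj; apply: lconvDl; exact: cvalC. Qed.
Lemma cconvDr : right_distributive cconv +%R.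
Proof. by move=> f g h; rewrite cconvC cconvDl !(cconvC f). Qed.
Lemma cconvZl a f g : cconv (a *: f) g = a *: cconv f g.
Proof. by apply: val_inj; apply: lconvZl; exact: cvalC. Qed.
Lemma cconvZr a f g : cconv f (a *: g) = a *: cconv f g.
Proof. by rewrite cconvC cconvZl cconvC. Qed.

Lemma cconv0 f : cconv 0 f = 0.
Proof. by apply: (addIr (cconv 0 f)); rewrite -cconvDl !add0r. Qed.

(** The pair (a, f) stands for a delta + f, with delta the Dirac mass at 0,
    the missing unit of convolution. *)
Definition unitization : Type := (C * cfun)%type.
HB.instance Definition _ := GRing.Zmodule.on unitization.

Definition uone : unitization := (1, 0).
Definition umul (x y : unitization) : unitization :=
  (x.1 * y.1, x.1 *: y.2 + y.1 *: x.2 + cconv x.2 y.2).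

Lemma umulC : commutative umul.
Proof.
move=> x y; rewrite /umul mulrC cconvC; congr (_, _ + _); exact: addrC.
Qed.

Lemma umulA : associative umul.
Proof.
move=> x y z; rewrite /umul/=; congr (_, _); first exact: mulrA.
rewrite !cconvDl !cconvDr !cconvZl !cconvZr !scalerDr !scalerA cconvA.
rewrite [z.1 * x.1]mulrC [z.1 * y.1]mulrC -!addrA; congr (_ + _).
congr (_ + _); rewrite [LHS]addrCA; congr (_ + _).
by rewrite [RHS]addrCA; congr (_ + _); exact: addrCA.
Qed.

Lemma umul1 : left_id uone umul.
Proof.
move=> [a f]; rewrite /umul/= mul1r scale1r scaler0 addr0.
by rewrite cconv0 addr0.
Qed.

Lemma umulDl : left_distributive umul +%R.
Proof.
move=> x y z; rewrite /umul/=; congr (_, _); first exact: mulrDl.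
rewrite scalerDl scalerDr cconvDl -!addrA; congr (_ + _).
rewrite addrCA; congr (_ + _); rewrite [RHS]addrCA; congr (_ + _); exact: addrCA.
Qed.

Lemma uone_neq0 : uone != 0.
Proof. by apply/eqP => -[/eqP]; rewrite oner_eq0. Qed.

HB.instance Definition _ := GRing.Zmodule_isComNzRing.Build unitization
  umulA umulC umul1 umulDl uone_neq0.

Definition uscal (a : C) : unitization := (a, 0).
Definition uemb (f : cfun) : unitization := (0, f).

Lemma uscal_zmod : zmod_morphism uscal.
Proof. by move=> a b; congr (_, _); rewrite subr0. Qed.
Lemma uscal_monoid : monoid_morphism uscal.
Proof.
split=> // a b; congr (_, _).
by rewrite /= !scaler0 cconv0 !addr0.
Qed.
HB.instance Definition _ := GRing.isZmodMorphism.Build C unitization uscal uscal_zmod.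
HB.instance Definition _ := GRing.isMonoidMorphism.Build C unitization uscal uscal_monoid.

Lemma uemb_zmod : zmod_morphism uemb.
Proof. by move=> a b; congr (_, _); rewrite subr0. Qed.
HB.instance Definition _ := GRing.isZmodMorphism.Build cfun unitization uemb uemb_zmod.

Lemma uemb_inj : injective uemb. Proof. by move=> f g []. Qed.

Lemma uembM f g : uemb f * uemb g = uemb (cconv f g).
Proof. by congr (_, _); rewrite /= ?mul0r// !scale0r !add0r. Qed.

Lemma uscalM a f : uscal a * uemb f = uemb (a *: f).
Proof.
by congr (_, _); rewrite /= ?mulr0// scale0r addr0 cconv0 addr0.
Qed.

(** Without a unit there is no power of exponent 0: the index i stands for i
    + 1 factors. *)
Fixpoint cpow f i : cfun := if i is i'.+1 then cconv f (cpow f i') else f.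

Lemma uemb_cpow f i : uemb (cpow f i) = uemb f ^+ i.+1.
Proof. by elim: i => [|i IH] //; rewrite exprS -IH uembM. Qed.

Lemma cpowE f i : cpow f i = lconvpow f i.+1 :> (R -> C).
Proof. by elim: i => [|i IH] //=; rewrite IH. Qed.

End CausalAlgebra.

(** * Causal functions and the space C_{-1} *)

Section ComplexContinuity.
Variable R : realType.
Notation C := R[i].
Notation Re := (@complex.Re R).
Notation Im := (@complex.Im R).
Local Open Scope complex_scope.

Lemma normc_Re_le (z : C) : (`|Re z|)%:C <= `|z|.
Proof.
by case: z => a b; rewrite normc_def/= lecR -sqrtr_sqr ler_wsqrtr// lerDl sqr_ge0.
Qed.

Lemma normc_Im_le (z : C) : (`|Im z|)%:C <= `|z|.
Proof.
by case: z => a b; rewrite normc_def/= lecR -sqrtr_sqr ler_wsqrtr// lerDr sqr_ge0.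
Qed.

Lemma normc_real (x : R) : `|x%:C| = `|x|%:C.
Proof. by rewrite normc_def/= expr0n/= addr0 sqrtr_sqr. Qed.

Lemma gt0_real (e : C) : 0 < e -> e = (Re e)%:C /\ 0 < Re e.
Proof. by case: e => a b; rewrite ltcE/= => /andP[/eqP -> ?]. Qed.

Lemma continuous_Re : continuous (Re : C^o -> R).
Proof.
move=> w; have FF : Filter (nbhs (w : C^o)) by exact: nbhs_filter.
apply/(@cvgrPdist_lt R R^o C^o (nbhs (w : C^o)) FF) => e e0.
have e0' : 0 < e%:C by rewrite ltcR.
have := @cvg_id _ (nbhs (w : C^o)); move/(@cvgrPdist_lt C C^o C^o _ FF) => /(_ _ e0').
apply: filterS => z wz; rewrite -ltcR; apply: le_lt_trans wz.
apply: le_trans (normc_Re_le _); by case: (w) (z) => [a b] [c d].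
Qed.

Lemma continuous_Im : continuous (Im : C^o -> R).
Proof.
move=> w; have FF : Filter (nbhs (w : C^o)) by exact: nbhs_filter.
apply/(@cvgrPdist_lt R R^o C^o (nbhs (w : C^o)) FF) => e e0.
have e0' : 0 < e%:C by rewrite ltcR.
have := @cvg_id _ (nbhs (w : C^o)); move/(@cvgrPdist_lt C C^o C^o _ FF) => /(_ _ e0').
apply: filterS => z wz; rewrite -ltcR; apply: le_lt_trans wz.
apply: le_trans (normc_Im_le _); by case: (w) (z) => [a b] [c d].
Qed.

Lemma continuous_real_complex : continuous (fun x : R => x%:C : C^o).
Proof.
move=> x; apply/cvgrPdist_lt => e /gt0_real[-> e0].
have := @cvg_id _ (nbhs x); move/cvgrPdist_lt => /(_ _ e0).
by apply: filterS => y xy; rewrite -rmorphB/= normc_real ltcR.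
Qed.

Lemma cvg_complex (T : Type) (F : set_system T) (FF : Filter F) (f : T -> C) (l : C) :
  Re (f x) @[x --> F] --> Re l -> Im (f x) @[x --> F] --> Im l ->
  (fun x => f x : C^o) @ F --> (l : C^o).
Proof.
move=> fr fi.
have E (z : C) : z = (Re z)%:C + 'i%C * (Im z)%:C.
  by case: z => a b; simpc.
rewrite (E l).
have -> : (fun x => f x : C^o) = fun x => (Re (f x))%:C + 'i%C * (Im (f x))%:C.
  by apply/funext => x; exact: E.
apply: (@cvgD _ C^o).
  exact: (cvg_comp _ _ fr (@continuous_real_complex _)).
apply: (cvgMl_tmp (K := C)).
exact: (cvg_comp _ _ fi (@continuous_real_complex _)).
Qed.

(** On (0,T] the continuous factor is bounded, so that the product is
    O(t^p). *)
Lemma rCm1_powR_within p (u1 : R -> R) : -1 < p ->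
  {within `[0, +oo[, continuous u1} ->
  rCm1 (fun t => if 0 < t then t `^ p * u1 t else 0).
Proof.
move=> p1 cu; split.
  move=> x x0.
  have cx : {for x, continuous (fun t : R => t `^ p * u1 t)}.
    apply: continuousM; first exact: continuous_powR.
    have /continuous_within_itvcyP[H _] := cu.
    by apply: H; rewrite in_itv/= x0.
  move: cx; rewrite /prop_for /continuous_at.
  rewrite [X in _ --> X -> _](_ : _ = (fun t => if 0 < t then t `^ p * u1 t else 0) x) /= ?x0//.
  move=> cG; apply: cvg_trans cG; apply: near_eq_cvg; near=> y.
  by rewrite ifT//; near: y; exact: lt_nbhsr.
exists p => // T T0.
have cT : {within `[0, T], continuous (fun x => `|u1 x|)}.
  have : {within `[0, T], continuous u1}.
    by apply: continuous_subspaceW cu => x /=; rewrite !in_itv/= => /andP[->].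
  by move=> c x; apply: cvg_norm; exact: c.
have [c _ cM] := EVT_max (ltW T0) cT.
exists `|u1 c| => //.
move=> x xT; case: ifPn => x0; last first.
  by rewrite normr0 mulr_ge0 ?ppow_ge0.
rewrite normrM mulrC (ger0_norm (powR_ge0 x p)) ppow_gt0// ler_wpM2r ?powR_ge0//.
by apply: cM; rewrite in_itv/= (ltW x0).
Unshelve. all: by end_near. Qed.

Lemma cvg0_powR (r : R) : 0 < r -> forall e : R, 0 < e ->
  exists2 d, 0 < d & forall y, 0 < y -> y < d -> y `^ r < e.
Proof.
move=> r0 e e0; exists (e `^ r^-1); first exact: powR_gt0.
move=> y y0 yd; rewrite -[e](powRr1 (ltW e0)) -(mulVf (lt0r_neq0 r0)) powRrM.
by apply: gt0_ltr_powR; rewrite ?nnegrE ?powR_ge0// ltW.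
Qed.

(** Division by a strictly smaller power leaves O(t^(p-q)) at 0, so the
    quotient extends continuously by 0. *)
Lemma ppow_bounded_quotient_continuous p q (u : R -> R) : q < p ->
  (forall x, 0 < x -> {for x, continuous u}) -> ppow_bounded p u ->
  continuous (fun t => ppow (- q) t * u t).
Proof.
move=> qp cu pu x.
have [x0|x0|->] := ltgtP x 0.
- have : (fun=> 0 : R) @ x --> (ppow (- q) x * u x).
    by rewrite ppow_le0 ?mul0r; [exact: cvg_cst|exact: ltW].
  apply: cvg_trans; apply: near_eq_cvg; near=> y.
  rewrite ppow_le0 ?mul0r//; apply: ltW; near: y; exact: lt_nbhsl.
- apply: cvgM; last exact: cu.
  have := continuous_powR (p := - q) x0; rewrite /prop_for /continuous_at -(ppow_gt0 (- q) x0) => cG.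
  apply: cvg_trans cG; apply: near_eq_cvg; near=> y; rewrite ppow_gt0//.
  by near: y; exact: lt_nbhsr.
- apply/cvgrPdist_lt => e e0; rewrite (ppow_le0 _ (lexx 0)) mul0r.
  have [M M0 Mu] := pu 1 ltr01.
  have M1 : 0 < M + 1 by rewrite ltr_pwDr.
  have pq : 0 < p - q by rewrite subr_gt0.
  have [d d0 dP] := cvg0_powR pq (divr_gt0 e0 M1).
  near=> y; rewrite sub0r normrN normrM.
  have [y0|y0] := leP y 0; first by rewrite ppow_le0// normr0 mul0r.
  rewrite ger0_norm ?ppow_ge0//.
  have yd : y < d by near: y; exact: lt_nbhsl.
  have y1 : y <= 1 by apply: ltW; near: y; exact: lt_nbhsl.
  apply: (@le_lt_trans _ _ (M * y `^ (p - q))).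
    apply: (le_trans (ler_wpM2l (ppow_ge0 _ _) (Mu y y1))).
    rewrite !ppow_gt0// powRD ?(gt_eqF y0) ?implybT//.
    by rewrite le_eqVlt; apply/orP; left; apply/eqP; ring.
  apply: (@le_lt_trans _ _ ((M + 1) * y `^ (p - q))).
    by rewrite ler_wpM2r ?powR_ge0// lerDl.
  by rewrite mulrC -ltr_pdivlMr// dP.
Unshelve. all: by end_near. Qed.

Lemma inCm1_causal (f : R -> C) : inCm1 f -> cCm1 (causal f).
Proof.
move=> [p [f1 [p1 cf fE]]]; split.
  have -> : (fun x => Re (causal f x)) =
      (fun t => if 0 < t then t `^ p * Re (f1 t) else 0).
    apply/funext => t; rewrite /causal; case: ifPn => // t0.
    by rewrite fE// cReM/= mul0r subr0.
  apply: rCm1_powR_within => // x; apply: continuous_comp; [exact: cf|exact: continuous_Re].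
have -> : (fun x => Im (causal f x)) =
    (fun t => if 0 < t then t `^ p * Im (f1 t) else 0).
  apply/funext => t; rewrite /causal; case: ifPn => // t0.
  by rewrite fE// cImM/= mul0r addr0.
apply: rCm1_powR_within => // x; apply: continuous_comp; [exact: cf|exact: continuous_Im].
Qed.

(** The real and the imaginary part may come with different exponents; a
    single r below both of them is divided out. *)
Lemma cCm1_inCm1 (f g : R -> C) : cCm1 f -> (forall t, 0 < t -> g t = f t) -> inCm1 g.
Proof.
move=> [[cr [p p1 pr]] [ci [q q1 qi]]] gf.
have [r r1 [rp rq]] : exists2 r, -1 < r & r < p /\ r < q.
  have m1 : -1 < Num.min p q by rewrite lt_min p1.
  (* The midpoint of -1 and the smaller exponent. *)
  exists ((Num.min p q - 1) / 2); first by lra.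
  have [mp mq] : Num.min p q <= p /\ Num.min p q <= q by rewrite !ge_min !lexx orbT.
  by split; lra.
exists r, (fun t => (ppow (- r) t)%:C * f t); split => //.
  apply: continuous_subspaceT => x; apply: cvg_complex.
    under eq_fun do rewrite cReM/= mul0r subr0.
    by rewrite cReM/= mul0r subr0; exact: (ppow_bounded_quotient_continuous rp cr pr).
  under eq_fun do rewrite cImM/= mul0r addr0.
  by rewrite cImM/= mul0r addr0; exact: (ppow_bounded_quotient_continuous rq ci qi).
move=> t t0; rewrite gf// mulrA -rmorphM/= ppow_gt0// -powRD ?(gt_eqF t0) ?implybT//.
by rewrite subrr powRr0 mul1r.
Qed.

Lemma inCm10_inCm1 (f : R -> C) : inCm10 f -> inCm1 f.
Proof. by move=> [p [f1 [p1 _ cf fE]]]; exists p, f1. Qed.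

End ComplexContinuity.

(** * Convergence of the Neumann series *)

Section Resolvent.
Variable R : realType.
Notation C := R[i].
Notation Re := (@complex.Re R).
Notation Im := (@complex.Im R).
Implicit Types (f g h : cfun R) (a z : C) (A : R).

(** Componentwise bounds, rather than bounds of the modulus, split every
    complex estimate into real ones. *)
Definition cle z A : Prop := `|Re z| <= A /\ `|Im z| <= A.

Definition cabs z : R := `|Re z| + `|Im z|.

Lemma cle_trans z A B : cle z A -> A <= B -> cle z B.
Proof. by move=> [r i] AB; split; exact: le_trans AB. Qed.

Lemma cleM a z A : cle z A -> cle (a * z) (cabs a * A).
Proof.
move=> [r i]; split; rewrite ?cReM ?cImM /cabs mulrDl.
  rewrite (le_trans (ler_normB _ _))// !normrM lerD// ler_wpM2l//.
by rewrite (le_trans (ler_normD _ _))// !normrM lerD// ler_wpM2l.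
Qed.

Lemma cReB (z w : C) : Re (z - w) = Re z - Re w.
Proof. by case: z w => [a b] [c d]. Qed.

Lemma cImB (z w : C) : Im (z - w) = Im z - Im w.
Proof. by case: z w => [a b] [c d]. Qed.

Lemma cleD z w A B : cle z A -> cle w B -> cle (z + w) (A + B).
Proof.
move=> [r i] [r' i']; split; rewrite ?cReD ?cImD (le_trans (ler_normD _ _))// lerD//.
Qed.

Lemma cleN z A : cle z A -> cle (- z) A.
Proof. by case: z => x y [r i]; split; rewrite /= normrN. Qed.

Lemma cle_eq0 z A : (forall n, cle z (A * 2^-1 ^+ n)) -> z = 0.
Proof.
move=> H; have A0 : 0 <= A.
  by have [h _] := H 0%N; move: h; rewrite expr0 mulr1; apply: le_trans.
have H0 (x : R) : (forall n, `|x| <= A * 2^-1 ^+ n) -> x = 0.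
  move=> xA; apply/normr0_eq0/le_anti; rewrite normr_ge0 andbT.
  have cv : (fun n => A * 2^-1 ^+ n) @ \oo --> (A * 0 : R).
    by apply: cvgMl_tmp; apply: cvg_expr; rewrite ger0_norm//; lra.
  rewrite -(mulr0 A) -(cvg_lim (@Rhausdorff R) cv).
  by apply: limr_ge; [exact: (cvgP _ cv)|exact: nearW].
by apply: complex_inj; apply: H0 => n; have [] := H n.
Qed.

Definition cppow_bounded p f : Prop := forall T, 0 < T ->
  exists2 M, 0 <= M & forall x, x <= T -> cle (f x) (M * ppow p x).

Lemma cfun_ppow_bounded f : exists p, [/\ -1 < p, p <= 0 & cppow_bounded p f].
Proof.
have [[_ [p p1 pr]] [_ [q q1 qi]]] := cvalC f.
pose r := Num.min (Num.min p q) 0.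
have r1 : -1 < r by rewrite /r !lt_min p1 q1 ltrN10.
have [rp rq r0] : [/\ r <= p, r <= q & r <= 0] by rewrite /r !ge_min !lexx !orbT.
exists r; split=> // T T0.
have [M M0 Mr] := ppow_bounded_weaken rp pr T0; have [N N0 Ni] := ppow_bounded_weaken rq qi T0.
exists (M + N); first exact: addr_ge0.
move=> x xT; split; rewrite mulrDl.
  by rewrite (le_trans (Mr x xT))// lerDl mulr_ge0 ?ppow_ge0.
by rewrite (le_trans (Ni x xT))// lerDr mulr_ge0 ?ppow_ge0.
Qed.

Lemma cle_conv f g t A :
  `|rconv (fun x => Re (f x)) (fun x => Re (g x)) t| <= A ->
  `|rconv (fun x => Im (f x)) (fun x => Im (g x)) t| <= A ->
  `|rconv (fun x => Re (f x)) (fun x => Im (g x)) t| <= A ->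
  `|rconv (fun x => Im (f x)) (fun x => Re (g x)) t| <= A ->
  cle (cconv f g t) (2 * A).
Proof.
move=> h1 h2 h3 h4; split; rewrite mulr2n mulrDl !mul1r.
  rewrite [Re _](Re_lconv t (cvalC f) (cvalC g)) (le_trans (ler_normB _ _))// lerD//.
rewrite [Im _](Im_lconv t (cvalC f) (cvalC g)) (le_trans (ler_normD _ _))// lerD//.
Qed.

Lemma cle_conv_bounded p M N T t f g : -1 < p -> 0 <= M -> 0 <= N -> 0 < T -> t <= T ->
  (forall x, x <= T -> cle (f x) (M * ppow p x)) ->
  (forall x, x <= T -> cle (g x) (N * ppow p x)) ->
  cle (cconv f g t) (2 * (M * N * euler_beta p p * ppow (p + p + 1) t)).
Proof.
move=> p1 M0 N0 T0 tT fM gN; have [fr fi] := cvalC f; have [gr gi] := cvalC g.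
apply: cle_conv; apply: (@bounded_rconv_le _ _ _ _ _ _ T) => //;
  try exact: rCm1_measurable;
  by move=> x xT; have [? ?] := fM x xT; have [? ?] := gN x xT.
Qed.

Lemma cle_conv_weighted p b s M N T t f g : -1 < p - b -> 0 < b <= 1 ->
  0 < s -> 0 <= M -> 0 <= N -> 0 < T -> t <= T ->
  (forall x, x <= T -> cle (f x) (M * ppow p x)) ->
  (forall x, x <= T -> cle (g x) (N * (expR (s * x) * ppow p x))) ->
  cle (cconv f g t) (2 * (N * (M * (s `^ (- b) * euler_beta (p - b) p * T `^ (p - b + 1))) *
     (expR (s * t) * ppow p t))).
Proof.
move=> pb b1 s0 M0 N0 T0 tT fM gN; have [fr fi] := cvalC f; have [gr gi] := cvalC g.
apply: cle_conv; apply: rconv_weighted_le => //;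
  by move=> x xT; have [? ?] := fM x xT; have [? ?] := gN x xT.
Qed.

Lemma powRN_small b e : 0 < b -> 0 < e -> exists2 s : R, 0 < s & s `^ (- b) < e.
Proof.
move=> b0 e0; have [d d0 dP] := cvg0_powR b0 e0.
exists (2 / d); first by rewrite divr_gt0.
have -> : 2 / d = (d / 2) `^ (-1) by rewrite powR_inv1 ?invf_div// divr_ge0// ltW.
rewrite -powRrM mulrNN mul1r dP ?divr_gt0//.
by rewrite ltr_pdivrMr// ltr_pMr// ltr1n.
Qed.

Variables (kap : cfun R) (lam : C).

Definition neumann_term j : cfun R := lam ^+ j *: cpow kap j.

Lemma neumann_termS j : neumann_term j.+1 = lam *: cconv kap (neumann_term j).
Proof. by rewrite /neumann_term cconvZr scalerA -exprS. Qed.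

(** By induction on j in the norm weighted by e^(-st): s is chosen such that
    one more convolution with lam kap halves that norm. On (0,T] the weight
    is bounded by e^(sT), which is then absorbed in M. *)
Lemma neumann_term_bound p : -1 < p -> p <= 0 -> cppow_bounded p kap ->
  forall T, 0 < T -> exists2 M, 0 <= M &
    forall j x, x <= T -> cle (neumann_term j x) (M * 2^-1 ^+ j * ppow p x).
Proof.
move=> p1 p0 kd T T0; have [M M0 kM] := kd T T0.
(* Half of the available room: p - b > -1 and b > 0. *)
pose b := (p + 1) / 2.
have pb : -1 < p - b by rewrite /b; lra.
have b0 : 0 < b by rewrite /b; lra.
have b1 : b <= 1 by rewrite /b; lra.
pose B := euler_beta (p - b) p * T `^ (p - b + 1).
have B0 : 0 <= B by rewrite mulr_ge0 ?euler_beta_ge0 ?powR_ge0.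
have L0 : 0 <= cabs lam by rewrite addr_ge0.
(* The norm of convolution with lam kap is at most D s^(-b); the summand 1
   makes D positive, whatever lam and M are. *)
pose D := cabs lam * (2 * (M * B)) + 1.
have D0 : 0 < D by rewrite /D ltr_wpDl//; apply: mulr_ge0 => //; apply: mulr_ge0 => //; exact: mulr_ge0.
have e0 : 0 < (2 * D)^-1 by rewrite invr_gt0 mulr_gt0.
have [s s0 sD] := powRN_small b0 e0.
have IH j : forall x, x <= T -> cle (neumann_term j x) (M * 2^-1 ^+ j * (expR (s * x) * ppow p x)).
  elim: j => [|j IH] x xT.
    rewrite /neumann_term expr0 scale1r mulr1 /=; apply: cle_trans (kM x xT) _.
    have [x0|x0] := leP x 0; first by rewrite ppow_le0// !mulr0.
    rewrite ler_wpM2l// ler_peMl ?ppow_ge0//.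
    by rewrite -expR0 ler_expR mulr_ge0// ltW.
  have N0 : 0 <= M * 2^-1 ^+ j by rewrite mulr_ge0// exprn_ge0.
  have bb : 0 < b <= 1 by rewrite b0.
  have H := cle_conv_weighted pb bb s0 M0 N0 T0 xT kM IH.
  rewrite neumann_termS cfunZE; apply: cle_trans (cleM lam H) _.
  set E := expR _ * _; set N := M * 2^-1 ^+ j in N0 *.
  have E0 : 0 <= E by rewrite mulr_ge0 ?expR_ge0 ?ppow_ge0.
  have sb := powR_ge0 s (- b).
  rewrite exprS (_ : M * _ * E = N * E * 2^-1); last by rewrite /N; ring.
  rewrite (_ : cabs lam * _ = N * E * (cabs lam * (2 * (M * B)) * s `^ (- b))); last by rewrite /B; ring.
  have NE0 : 0 <= N * E by exact: mulr_ge0.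
  rewrite ler_wpM2l//.
  apply: (@le_trans _ _ (D * s `^ (- b))).
    by rewrite ler_wpM2r// /D lerDl.
  apply: (@le_trans _ _ (D * (2 * D)^-1)).
    by rewrite ler_wpM2l ?ltW.
  by rewrite invfM mulrCA divff ?gt_eqF// mulr1.
exists (M * expR (s * T)); first by rewrite mulr_ge0 ?expR_ge0.
move=> j x xT; apply: cle_trans (IH j x xT) _.
rewrite -!mulrA ler_wpM2l// [leRHS]mulrCA ler_wpM2l ?exprn_ge0// ler_wpM2r ?ppow_ge0//.
by rewrite ler_expR ler_wpM2l// ltW.
Qed.

Lemma Re_sum (I : Type) (r : seq I) (P : pred I) (F : I -> C) :
  Re (\sum_(i <- r | P i) F i) = \sum_(i <- r | P i) Re (F i).
Proof. by apply: (big_morph Re) => // x y; exact: cReD. Qed.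

Lemma Im_sum (I : Type) (r : seq I) (P : pred I) (F : I -> C) :
  Im (\sum_(i <- r | P i) F i) = \sum_(i <- r | P i) Im (F i).
Proof. by apply: (big_morph Im) => // x y; exact: cImD. Qed.

Lemma cfun_sumE (n : nat) (F : nat -> cfun R) t :
  (\sum_(0 <= j < n) F j) t = \sum_(0 <= j < n) F j t.
Proof.
by apply: (big_morph (fun f : cfun R => f t)) => // f g.
Qed.

(** The partial sums satisfy S_(n+1) = kap + lam kap * S_n. Since L - S_n is
    O(2^(-n) x^p) on (0,t], so is its convolution with kap up to a power of
    t, and the recurrence passes to the limit. *)
Lemma resolvent_exists : exists L : cfun R,
  [/\ L = kap + lam *: cconv kap L &
      forall t, (fun n => \sum_(0 <= j < n) neumann_term j t : C^o) @ \oo --> (L t : C^o)].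
Proof.
have [p [p1 p0 kd]] := cfun_ppow_bounded kap.
have lb := neumann_term_bound p1 p0 kd.
have [||Lr cvr rr] := @rCm1_series R p (fun j x => Re (neumann_term j x)) p1.
- by move=> j; have [] := cvalC (neumann_term j).
- by move=> T T0; have [M M0 h] := lb T T0; exists M => // j x xT; have [] := h j x xT.
have [||Li cvi ri] := @rCm1_series R p (fun j x => Im (neumann_term j x)) p1.
- by move=> j; have [] := cvalC (neumann_term j).
- by move=> T T0; have [M M0 h] := lb T T0; exists M => // j x xT; have [] := h j x xT.
pose l (t : R) : C := (limn (series (fun j => Re (neumann_term j t))) +i* limn (series (fun j => Im (neumann_term j t))))%C.
have lC : cCm1 l by split.
pose L := cfun_of lC; exists L.
pose S n := \sum_(0 <= j < n) neumann_term j.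
have SS n : S n.+1 = kap + lam *: cconv kap (S n).
  rewrite /S big_nat_recl//= /neumann_term expr0 scale1r /=; congr (_ + _).
  elim: n => [|n IH]; first by rewrite !big_nil cconvC cconv0 scaler0.
  by rewrite !big_nat_recr//= IH cconvDr scalerDr -(neumann_termS n).
have rS T : 0 < T -> exists2 K, 0 <= K &
    forall n x, x <= T -> cle ((L - S n) x) (K * 2^-1 ^+ n * ppow p x).
  move=> T0; have [K K0 Kr] := rr T T0; have [K' K'0 Ki] := ri T T0.
  exists (K + K'); first exact: addr_ge0.
  move=> n x xT; have P0 : 0 <= 2^-1 ^+ n * ppow p x :> R by rewrite mulr_ge0 ?ppow_ge0 ?exprn_ge0.
  have -> : (L - S n) x = l x - \sum_(0 <= j < n) neumann_term j x by rewrite -cfun_sumE.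
  split; rewrite -mulrA mulrDl.
    rewrite cReB Re_sum; apply: (le_trans (Kr n x xT)).
    by rewrite -mulrA lerDl mulr_ge0.
  rewrite cImB Im_sum; apply: (le_trans (Ki n x xT)).
  by rewrite -mulrA lerDr mulr_ge0.
split; last first.
  move=> t; apply: cvg_complex.
    by under eq_fun do rewrite Re_sum; exact: cvr.
  by under eq_fun do rewrite Im_sum; exact: cvi.
apply: cfunP => t; have [t0|t0] := leP t 0.
  by rewrite !(cCm1_causal (cvalC _) t0).
apply/eqP; rewrite -subr_eq0; apply/eqP.
have [M M0 kM] := kd t t0; have [K K0 LK] := rS t t0.
apply: (@cle_eq0 _ (K * ppow p t + cabs lam * (2 * (M * K * euler_beta p p * ppow (p + p + 1) t)))) => n.
have -> : L t - (kap + lam *: cconv kap L) t =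
    (L - S n.+1) t + - (lam * cconv kap (L - S n) t).
  rewrite SS (_ : cconv kap (L - S n) = cconv kap L - cconv kap (S n)); last first.
    by rewrite cconvDr; congr (_ + _); rewrite -scaleN1r cconvZr scaleN1r.
  have E (f g : cfun R) : (f - g) t = f t - g t by [].
  by rewrite !E !cfunDE !cfunZE; ring.
rewrite mulrDl; apply: cleD.
  apply: cle_trans (LK n.+1 t (lexx t)) _.
  rewrite mulrAC ler_wpM2l ?mulr_ge0 ?ppow_ge0//.
  by rewrite exprS ler_piMl ?exprn_ge0// invf_le1// ler1n.
apply: cleN; rewrite -mulrA; apply: cleM.
have K2 : 0 <= K * 2^-1 ^+ n by rewrite mulr_ge0 ?exprn_ge0.
apply: cle_trans (cle_conv_bounded p1 M0 K2 t0 (lexx t) kM (LK n)) _.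
by rewrite le_eqVlt; apply/orP; left; apply/eqP; ring.
Qed.

End Resolvent.

(** * Derivatives of iterated primitives *)

Section Derivatives.
Variable R : realType.
Notation C := R[i].
Notation Re := (@complex.Re R).
Notation Im := (@complex.Im R).
Implicit Types (F G : R -> C) (f g : cfun R) (t : R).

Lemma eq_cderivable F G t : (forall x, 0 < x -> F x = G x) -> 0 < t ->
  cderivable F t -> cderivable G t.
Proof.
move=> FG t0 [dr di]; split; [apply: near_eq_derivable dr|apply: near_eq_derivable di];
  near=> x; rewrite FG//; near: x; exact: lt_nbhsr.
Unshelve. all: by end_near. Qed.

Lemma eq_cderive F G t : (forall x, 0 < x -> F x = G x) -> 0 < t ->
  cderive F t = cderive G t.
Proof.
move=> FG t0; rewrite /cderive !derive1E.
by congr (_ +i* _)%C; apply: near_eq_derive; near=> x; rewrite FG//; near: x; exact: lt_nbhsr.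
Unshelve. all: by end_near. Qed.

Lemma cderivableD F G t : cderivable F t -> cderivable G t ->
  cderivable (fun x => F x + G x) t.
Proof.
move=> [fr fi] [gr gi]; split.
  have -> : (fun x => Re (F x + G x)) = (fun x => Re (F x)) + (fun x => Re (G x)).
    by apply/funext => x; exact: cReD.
  exact: (derivableD fr gr).
have -> : (fun x => Im (F x + G x)) = (fun x => Im (F x)) + (fun x => Im (G x)).
  by apply/funext => x; exact: cImD.
exact: (derivableD fi gi).
Qed.

Lemma cderiveD F G t : cderivable F t -> cderivable G t ->
  cderive (fun x => F x + G x) t = cderive F t + cderive G t.
Proof.
move=> [fr fi] [gr gi]; rewrite /cderive; apply: complex_inj; rewrite ?cReD ?cImD /= !derive1E.
  have -> : (fun x => Re (F x + G x)) = (fun x => Re (F x)) + (fun x => Re (G x)).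
    by apply/funext => x; exact: cReD.
  by rewrite (deriveD fr gr).
have -> : (fun x => Im (F x + G x)) = (fun x => Im (F x)) + (fun x => Im (G x)).
  by apply/funext => x; exact: cImD.
by rewrite (deriveD fi gi).
Qed.

Lemma cderivenS l F : cderiven l.+1 F = cderive (cderiven l F).
Proof. by []. Qed.

Lemma cderivenD n F G : cderivablen n F -> cderivablen n G ->
  forall i, (i <= n)%N -> forall t, 0 < t ->
  cderiven i (fun x => F x + G x) t = cderiven i F t + cderiven i G t.
Proof.
move=> Fn Gn; elim=> // i IH lin t t0; rewrite !cderivenS.
rewrite (eq_cderive (IH (ltnW lin)) t0) cderiveD//; [exact: Fn|exact: Gn].
Qed.

Lemma cderivablenD n F G : cderivablen n F -> cderivablen n G ->
  cderivablen n (fun x => F x + G x).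
Proof.
move=> Fn Gn i lin t t0.
apply: (@eq_cderivable (fun x => cderiven i F x + cderiven i G x)) => //.
  by move=> x x0; rewrite (cderivenD Fn Gn (ltnW lin)).
by apply: cderivableD; [exact: Fn|exact: Gn].
Qed.

Lemma cCm1_heaviside : cCm1 (fun x : R => (ppow 0 x)%:C%C).
Proof. by split=> /=; [apply: rCm1_ppow|exact: rCm1_0]. Qed.

Definition heaviside : cfun R := cfun_of cCm1_heaviside.

Lemma rconv0l (u : R -> R) t : rCm1 u -> rconv (fun=> 0) u t = 0.
Proof.
move=> uC; rewrite /rconv; under eq_Rintegral do rewrite mul0r.
by rewrite Rintegral_cst// mul0r.
Qed.

Lemma Re_heaviside f : (fun x => Re (cconv heaviside f x)) = rconv (ppow 0) (fun x => Re (f x)).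
Proof.
have [fr fi] := cvalC f; apply/funext => x.
rewrite [LHS](Re_lconv x (cvalC heaviside) (cvalC f)) /=.
by rewrite rconv0l// subr0.
Qed.

Lemma Im_heaviside f : (fun x => Im (cconv heaviside f x)) = rconv (ppow 0) (fun x => Im (f x)).
Proof.
have [fr fi] := cvalC f; apply/funext => x.
rewrite [LHS](Im_lconv x (cvalC heaviside) (cvalC f)) /=.
by rewrite rconv0l// addr0.
Qed.

Lemma cderive_heaviside f t : 0 < t ->
  cderivable (cconv heaviside f) t /\ cderive (cconv heaviside f) t = f t.
Proof.
move=> t0; have [fr fi] := cvalC f.
have [dr er] := is_derive_rconv1 fr t0; have [di ei] := is_derive_rconv1 fi t0.
rewrite /cderivable /cderive Re_heaviside Im_heaviside; split; first by split; [exact: dr|exact: di].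
by rewrite !derive1E er ei; case: (f t).
Qed.

Lemma cderiven_heaviside n F f : (forall t, 0 < t -> F t = iter n (cconv heaviside) f t) ->
  forall i, (i <= n)%N -> forall t, 0 < t ->
  cderiven i F t = iter (n - i) (cconv heaviside) f t.
Proof.
move=> FE; elim=> [_ t t0|i IH lin t t0]; first by rewrite subn0 -FE.
rewrite cderivenS (eq_cderive (IH (ltnW lin)) t0) -(subnSK lin) iterS.
by have [_ ->] := cderive_heaviside (iter (n - i.+1) (cconv heaviside) f) t0.
Qed.

Lemma cderivablen_heaviside n F f : (forall t, 0 < t -> F t = iter n (cconv heaviside) f t) ->
  cderivablen n F.
Proof.
move=> FE i lin t t0.
apply: (@eq_cderivable (iter (n - i) (cconv heaviside) f)) => //.
  by move=> x x0; rewrite (cderiven_heaviside FE (ltnW lin)).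
rewrite -(subnSK lin) iterS.
by have [] := cderive_heaviside (iter (n - i.+1) (cconv heaviside) f) t0.
Qed.

(** The functions h_n are the convolution powers of h_1, the Heaviside
    function. *)
Lemma cpow_heaviside i t : 0 < t -> cpow heaviside i t = hfun i.+1 t.
Proof.
move=> t0; suff -> : cpow heaviside i t = ((i`!%:R)^-1 * ppow i%:R t)%:C%C.
  by rewrite /hfun/= ppow_gt0// powR_mulrn ?(ltW t0)// mulrC.
move: {t0}t; elim: i => [|i IH] t; first by rewrite fact0 invr1 mul1r.
have Er : (fun x => Re (cpow heaviside i x)) = fun x => (i`!%:R)^-1 * ppow i%:R x.
  by apply/funext => x; rewrite IH.
have Ei : (fun x => Im (cpow heaviside i x)) = fun x => 0 * ppow i%:R x.
  by apply/funext => x; rewrite IH/= mul0r.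
have pC : rCm1 (ppow i%:R : R -> R).
  by apply: rCm1_ppow; rewrite (lt_le_trans _ (ler0n _ _))// ltrN10.
have p0 : rCm1 (ppow 0 : R -> R) by apply: rCm1_ppow.
apply: complex_inj.
  rewrite -[LHS]/((fun x => Re (cconv heaviside (cpow heaviside i) x)) t) Re_heaviside Er.
  rewrite rconvC ?rconvZl//; last exact: rCm1Z.
  rewrite (rconvC pC p0) rconv1_ppow/= factS natrM invfM mulrA; congr (_ * _); exact: mulrC.
rewrite -[LHS]/((fun x => Im (cconv heaviside (cpow heaviside i) x)) t) Im_heaviside Ei.
by rewrite rconvC ?rconvZl ?mul0r//; exact: rCm1Z.
Qed.

Lemma iter_heaviside n f : uemb (iter n (cconv heaviside) f) = uemb heaviside ^+ n * uemb f.
Proof. by elim: n => [|n IH]; rewrite ?mul1r//= -uembM IH exprS mulrA. Qed.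

End Derivatives.

(** * The fractional derivative as a left inverse of convolution with kappa *)

Section FractionalDerivative.
Variables (R : realType) (n : nat) (kappa k : R -> R[i]) (kap : cfun R).
Hypotheses (n_gt0 : (0 < n)%N) (kC : cCm1 (causal k)).
Hypothesis kapE : forall t, 0 < t -> kap t = kappa t.
Hypothesis kk : forall t, 0 < t -> lconv kappa k t = hfun n t.

Lemma lconv_kappa_k : cconv kap (cfun_of kC) = cpow (heaviside R) n.-1.
Proof.
apply: cfunP => t; have [t0|t0] := leP t 0.
  by rewrite !(cCm1_causal (cvalC _) t0).
rewrite cpow_heaviside// prednK// -kk//=.
congr (_ t); apply: eq_lconv => x x0; first exact: kapE.
by rewrite -[LHS]/(causal k x) causalE.
Qed.

(** By associativity, from kappa * k = h_n: convolution with h_n is the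
    n-fold primitive. *)
Lemma lconv_k_kappa (Y : cfun R) : lconv k (cconv kap Y) = iter n (cconv (heaviside R)) Y.
Proof.
rewrite -lconv_causall -[LHS]/(cval (cconv (cfun_of kC) (cconv kap Y))); congr cval.
apply: uemb_inj; rewrite iter_heaviside -!uembM mulrA [uemb (cfun_of kC) * _]mulrC uembM.
by rewrite lconv_kappa_k uemb_cpow prednK.
Qed.

(** The fractional derivative kills g, and it undoes convolution with kappa
    because k * (kappa * Y) is the n-fold primitive of Y. *)
Lemma gfd_step (g F : R -> R[i]) (Y : cfun R) : inKer n k g ->
  (forall t, 0 < t -> F t = g t + cconv kap Y t) ->
  cderivablen n (lconv k F) /\ forall t, 0 < t -> gfd n k F t = Y t.
Proof.
move=> [[gC /(_ 0%N isT)[gd _]] g0] FE.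
have gC' := inCm1_causal gC.
have E : lconv k F = fun x => lconv k g x + iter n (cconv (heaviside R)) Y x.
  rewrite -lconv_k_kappa.
  pose gc := cfun_of gC'.
  have -> : lconv k F = cconv (cfun_of kC) (gc + cconv kap Y).
    apply: eq_lconv => t t0; first by rewrite -[RHS]/(causal k t) causalE.
    by rewrite FE// cfunDE -[gc t]/(causal g t) causalE.
  rewrite cconvDr; apply/funext => x; rewrite cfunDE /=.
  by rewrite lconv_causal lconv_causall.
have d2 : cderivablen n (iter n (cconv (heaviside R)) Y) by exact: (@cderivablen_heaviside R n _ Y).
split; first by rewrite E; exact: (cderivablenD gd d2).
move=> t t0; rewrite /gfd E (cderivenD gd d2)// (@cderiven_heaviside R n (iter n (cconv (heaviside R)) Y) Y)// subnn/=.
by rewrite -[X in X + _]/(gfd n k g t) g0// add0r.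
Qed.

(** Makes the problem with homogeneous initial conditions an instance of the
    general one. *)
Lemma gfd_inKer0 : inKer n k (fun=> 0).
Proof.
have E : forall t, 0 < t -> lconv k (fun=> 0) t = iter n (cconv (heaviside R)) 0 t.
  move=> t t0; rewrite -lconv_k_kappa; congr (_ t).
  by apply: eq_lconv => // x x0; rewrite cconvC cconv0.
have d := cderivablen_heaviside E.
have g0 t : 0 < t -> gfd n k (fun=> 0) t = 0.
  by move=> t0; rewrite /gfd (cderiven_heaviside E)// subnn.
have z0 (g : R -> R[i]) : (forall t, 0 < t -> g t = 0) -> inCm1 g.
  by move=> H; apply: (cCm1_inCm1 (cCm1_0 R)) => t t0; rewrite H.
split; last exact: g0.
split; first exact: z0.
by move=> [_|//]; split; [exact: d|exact: z0].
Qed.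

End FractionalDerivative.

(** * Partial fractions over a field *)

Section PartialFractions.
Variables (F : fieldType) (J : nat) (lam : 'I_J -> F) (c : F).
Hypotheses (lam_inj : injective lam) (c0 : c != 0).
Implicit Types (mult : 'I_J -> nat) (N : {poly F}) (a : 'I_J -> nat -> F).

Definition denom mult : {poly F} :=
  c *: \prod_(j < J) ('X - (lam j)%:P) ^+ mult j.

(** The part of the denominator that is prime to X - lam j. *)
Definition cofac mult (j : 'I_J) : {poly F} :=
  c *: \prod_(j' < J | j' != j) ('X - (lam j')%:P) ^+ mult j'.

(** The denominator divided by (X - lam j)^i, so that the coefficient of
    1/(X - lam j)^i multiplies a polynomial. *)
Definition pfbasis mult (j : 'I_J) (i : nat) : {poly F} :=
  ('X - (lam j)%:P) ^+ (mult j - i) * cofac mult j.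

Definition pfsum mult a : {poly F} :=
  \sum_(j < J) \sum_(1 <= i < (mult j).+1) a j i *: pfbasis mult j i.

Lemma denomE mult j i : (i <= mult j)%N ->
  denom mult = ('X - (lam j)%:P) ^+ i * pfbasis mult j i.
Proof.
move=> ij; rewrite /denom /pfbasis /cofac mulrA -exprD subnKC//.
by rewrite (bigD1 j)//= -scalerAr.
Qed.

Lemma cofac_neq0 mult j : (cofac mult j).[lam j] != 0.
Proof.
rewrite hornerZ mulf_neq0// horner_prod; apply/prodf_neq0 => j' j'j.
by rewrite horner_exp hornerXsubC expf_neq0// subr_eq0 (inj_eq lam_inj) eq_sym.
Qed.

Lemma size_denom mult : size (denom mult) = (\sum_(j < J) mult j).+1.
Proof.
rewrite size_scale// size_prod => [|j _]; last by rewrite expf_neq0// polyXsubC_eq0.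
under eq_bigr do rewrite size_exp_XsubC -addn1.
by rewrite big_split/= sum1_card -addSn addnK.
Qed.

Lemma size_pfbasis mult j i : (i <= mult j)%N ->
  size (pfbasis mult j i) = (\sum_(j < J) mult j - i).+1.
Proof.
move=> ij; have := size_denom mult; rewrite (denomE ij) => sD.
have B0 : pfbasis mult j i != 0.
  rewrite mulf_neq0 ?expf_neq0 ?polyXsubC_eq0//.
  by apply: contraTneq (cofac_neq0 mult j) => ->; rewrite horner0 eqxx.
move: sD; rewrite size_mul ?expf_neq0 ?polyXsubC_eq0// size_exp_XsubC /= => sD.
have im : (i <= \sum_(j < J) mult j)%N by rewrite (leq_trans ij)// (bigD1 j)//= leq_addr.
by rewrite -subSn// -sD addnC addnK.
Qed.

(** By induction on the degree of the denominator: subtracting a_0 times the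
    term of highest order at lam j0 makes the numerator vanish there, for a
    suitable a_0, and one factor X - lam j0 cancels. *)
Lemma pfsum_exists mult N : (size N <= \sum_(j < J) mult j)%N ->
  exists a, N = pfsum mult a.
Proof.
move: {2}(\sum_(j < J) mult j)%N (erefl (\sum_(j < J) mult j)%N) => m.
elim: m mult N => [|m IH] mult N sm sN.
  exists (fun _ _ => 0); rewrite /pfsum big1 => [|j _].
    by apply/eqP; rewrite -size_poly_eq0; move: sN; rewrite sm leqn0.
  by rewrite big1// => i _; rewrite scale0r.
have [j0 j0m] : exists j0, (0 < mult j0)%N.
  apply/existsP; apply: contraPT sm; rewrite negb_exists => /forallP H.
  by rewrite big1// => j _; apply/eqP; rewrite -leqn0 leqNgt H.
(* The value for which the difference vanishes at lam j0. *)
pose a0 := N.[lam j0] / (cofac mult j0).[lam j0].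
have /factor_theorem[N' NE] : root (N - a0 *: cofac mult j0) (lam j0).
  by rewrite /root hornerD hornerN hornerZ /a0 divfK ?cofac_neq0// subrr.
pose mult' j := if j == j0 then (mult j0).-1 else mult j.
have mult'j j : j != j0 -> mult' j = mult j by rewrite /mult' => /negbTE ->.
have mult'0 : mult' j0 = (mult j0).-1 by rewrite /mult' eqxx.
have sm' : (\sum_(j < J) mult' j)%N = m.
  move: sm; rewrite (bigD1 j0)//= [in X in _ -> X](bigD1 j0)//= mult'0.
  under [in X in _ -> X]eq_bigr => j jj0 do rewrite mult'j//.
  lia.
have cE : cofac mult' j0 = cofac mult j0.
  by congr (_ *: _); apply: eq_bigr => j jj0; rewrite mult'j.
have BE j i : (1 <= i <= mult' j)%N ->
    pfbasis mult' j i * ('X - (lam j0)%:P) = pfbasis mult j i.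
  move=> /andP[i1 ij]; have [jj|jj] := eqVneq j j0.
    rewrite jj in ij *; rewrite /pfbasis cE mulrAC -exprSr mult'0 -subSn ?prednK//.
    by rewrite -mult'0.
  rewrite /pfbasis mult'j// -mulrA; congr (_ * _); rewrite /cofac -scalerAl; congr (_ *: _).
  rewrite (bigD1 j0)//= ?[RHS](bigD1 j0)//= 1?eq_sym//.
  rewrite mult'0 mulrAC -exprSr prednK//; congr (_ * _).
  by apply: eq_bigr => j' /andP[_ j'j]; rewrite mult'j.
have sN' : (size N' <= \sum_(j < J) mult' j)%N.
  have [->|N'0] := eqVneq N' 0; first by rewrite size_poly0.
  have : (size (N - a0 *: cofac mult j0)%R <= m.+1)%N.
    rewrite (leq_trans (size_polyD _ _))// geq_max -sm sN size_polyN.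
    rewrite (leq_trans (size_scale_leq _ _))//.
    have := size_pfbasis (leqnn (mult j0)); rewrite /pfbasis subnn expr0 mul1r => ->.
    by rewrite sm; lia.
  by rewrite NE size_mul ?polyXsubC_eq0// size_XsubC addn2/= ltnS sm'.
have [a' N'E] := IH mult' N' sm' sN'.
exists (fun j i => if (j == j0) && (i == mult j0) then a0 else a' j i).
have -> : N = N' * ('X - (lam j0)%:P) + a0 *: cofac mult j0 by rewrite -NE subrK.
rewrite N'E /pfsum mulr_suml [in RHS](bigD1 j0)//= [in LHS](bigD1 j0)//=.
rewrite addrAC; congr (_ + _); last first.
  apply: eq_bigr => j jj0; rewrite (negbTE jj0) mulr_suml mult'j//.
  apply: eq_big_nat => i ij.
  by rewrite -scalerAl BE// mult'j.
rewrite mulr_suml eqxx/= mult'0 prednK// [in RHS]big_nat_recr//= eqxx.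
rewrite {3}/pfbasis subnn expr0 mul1r; congr (_ + _).
apply: eq_big_nat => i /andP[i1 ij].
rewrite ltn_eqF// -scalerAl BE// mult'0 i1/=; lia.
Qed.

(** By descending induction on i: modulo (X - lam j)^(mult j - i + 1) every
    term of the sum vanishes except that of a j i, once the coefficients of
    higher order at lam j are known to be 0. *)
Lemma pfsum_eq0 mult a : pfsum mult a = 0 ->
  forall j i, (1 <= i <= mult j)%N -> a j i = 0.
Proof.
move=> S0 j; pose q := 'X - (lam j)%:P.
have step i : (1 <= i <= mult j)%N ->
    (forall i', (i < i' <= mult j)%N -> a j i' = 0) -> a j i = 0.
  move=> /andP[i1 ij] H; pose e := (mult j - i)%N.
  have dvq j' i' : (e < i')%N -> q ^+ e.+1 %| q ^+ i' * j' by move=> ei; rewrite dvdp_mulr// dvdp_exp2l.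
  have dv : q ^+ e.+1 %| a j i *: pfbasis mult j i.
    suff [r rd E] : exists2 r, q ^+ e.+1 %| r & pfsum mult a = a j i *: pfbasis mult j i + r.
      have -> : a j i *: pfbasis mult j i = - r.
        by apply/eqP; rewrite -subr_eq0 opprK -E S0.
      by rewrite dvdpNr.
    rewrite /pfsum (bigD1 j)//= (bigD1_seq i) ?iota_uniq ?mem_index_iota ?i1//=.
    rewrite -addrA; eexists; last reflexivity.
    apply: dvdp_add.
      rewrite big_seq_cond; apply: (big_ind (fun x => q ^+ e.+1 %| x)) => [||i'].
      - exact: dvdp0.
      - by move=> x y; exact: dvdp_add.
      rewrite mem_index_iota => /andP[/andP[i'1 i'j] ii'].
      have [li|li] := ltnP i i'; first by rewrite H ?scale0r ?dvdp0// li.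
      have {}li : (i' < i)%N by rewrite ltn_neqAle ii'.
      by rewrite /pfbasis -/q scalerAr; apply: dvq; rewrite /e; lia.
    apply: (big_ind (fun x => q ^+ e.+1 %| x)) => [||j' jj'].
    - exact: dvdp0.
    - by move=> x y; exact: dvdp_add.
    apply: (big_ind (fun x => q ^+ e.+1 %| x)) => [||i' _].
    - exact: dvdp0.
    - by move=> x y; exact: dvdp_add.
    rewrite /pfbasis /cofac (bigD1 j) 1?eq_sym//= -/q.
    rewrite -scalerAr scalerA mulrCA scalerAr; apply: dvq; rewrite /e; lia.
  move: dv; rewrite /pfbasis -/q -/e scalerAr exprSr dvdp_mul2l; last first.
    by rewrite expf_neq0// polyXsubC_eq0.
  rewrite dvdp_XsubCl /root hornerZ mulf_eq0 (negbTE (cofac_neq0 mult j)) orbF.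
  by move/eqP.
move=> i; have [d] := ubnP (mult j - i); elim: d i => // d IH i id ij.
apply: step => // i' /andP[ii' i'j]; apply: IH; lia.
Qed.

End PartialFractions.

(** * Homogenization of partial fractions *)

Section Homogenization.
Variables (F : fieldType) (A : comNzRingType) (iot : {rmorphism F -> A}) (K : A).
Implicit Types (p q : {poly F}).

(** This is K^d p(1/K), written without inverting K. *)
Definition homog (d : nat) p : A := \sum_(i < d.+1) iot p`_i * K ^+ (d - i).

Lemma homogD d p q : homog d (p + q) = homog d p + homog d q.
Proof.
rewrite /homog -big_split/=; apply: eq_bigr => i _.
by rewrite coefD rmorphD mulrDl.
Qed.

Lemma homogZ d a p : homog d (a *: p) = iot a * homog d p.
Proof.
rewrite /homog mulr_sumr; apply: eq_bigr => i _.
by rewrite coefZ rmorphM mulrA.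
Qed.

Lemma homog0 d : homog d 0 = 0.
Proof. by rewrite /homog big1// => i _; rewrite coef0 rmorph0 mul0r. Qed.

Lemma homog_sum d (I : Type) (r : seq I) (P : pred I) (f : I -> {poly F}) :
  homog d (\sum_(i <- r | P i) f i) = \sum_(i <- r | P i) homog d (f i).
Proof. by apply: (big_morph _ (homogD d) (homog0 d)). Qed.

Lemma homogS d p : (size p <= d.+1)%N -> homog d.+1 p = K * homog d p.
Proof.
move=> sp; rewrite /homog big_ord_recr/= nth_default// rmorph0 mul0r addr0 mulr_sumr.
apply: eq_bigr => i _; rewrite subSn -1?ltnS// exprS mulrCA//.
Qed.

Lemma homog_raise d i p : (size p <= d.+1)%N -> homog (d + i) p = K ^+ i * homog d p.
Proof.
move=> sp; elim: i => [|i IH]; first by rewrite addn0 mul1r.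
by rewrite addnS homogS ?IH ?exprS ?mulrA// (leq_trans sp)// ltnS leq_addr.
Qed.

(** Formally K (1/K - l) = 1 - l K. *)
Lemma homog_mulXsubC d l p : (size p <= d.+1)%N ->
  homog d.+1 (('X - l%:P) * p) = (1 - iot l * K) * homog d p.
Proof.
move=> sp; rewrite mulrBl homogD -scaleN1r homogZ mul_polyC homogZ (homogS sp).
rewrite rmorphN1 mulrBl mul1r mulN1r mulrA; congr (_ - _).
rewrite /homog big_ord_recl/= coefXM eqxx rmorph0 mul0r add0r.
by apply: eq_bigr => i _; rewrite coefXM/= subSS.
Qed.

Lemma homog_mulXsubCn d i l p : (size p <= d.+1)%N ->
  homog (d + i) (('X - l%:P) ^+ i * p) = (1 - iot l * K) ^+ i * homog d p.
Proof.
move=> sp; elim: i => [|i IH]; first by rewrite addn0 !mul1r.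
rewrite addnS !exprS -!mulrA homog_mulXsubC ?IH//.
rewrite (leq_trans (size_mul_leq _ _))// size_exp_XsubC/= addnC.
by rewrite -addSn leq_add2r.
Qed.

Lemma homogXn d j : (j <= d)%N -> homog d 'X^j = K ^+ (d - j).
Proof.
move=> jd; rewrite /homog (bigD1 (Ordinal (jd : j < d.+1)%N))//= coefXn eqxx rmorph1 mul1r.
rewrite big1 ?addr0// => i; rewrite -val_eqE/= => /negbTE ij.
by rewrite coefXn ij rmorph0 mul0r.
Qed.

Variables (J : nat) (lam : 'I_J -> F) (c : F) (mult : 'I_J -> nat) (L : 'I_J -> A).
Hypotheses (lam_inj : injective lam) (c0 : c != 0).
Hypothesis LK : forall j, L j = K + iot (lam j) * (K * L j).
Let m := (\sum_(j < J) mult j)%N.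
Let D := denom lam c mult.

(** The equation of L j reads (1 - lam j K) L j = K. So dividing by (X - lam
    j)^i, which lowers the degree by i and thereby releases a factor K^i,
    amounts to multiplying by (L j)^i. *)
Lemma homog_pfbasis j i : (i <= mult j)%N ->
  homog m (pfbasis lam c mult j i) = L j ^+ i * homog m D.
Proof.
move=> ij; have im : (i <= m)%N by rewrite (leq_trans ij)// /m (bigD1 j)//= leq_addr.
have sB := size_pfbasis lam_inj c0 ij.
rewrite /D (denomE _ _ ij) -(subnK im) homog_mulXsubCn ?sB//.
rewrite homog_raise ?sB// mulrA -exprMn; congr (_ ^+ _ * _).
by rewrite mulrBr mulr1 [X in X - _]LK; ring.
Qed.

Lemma homog_prod (s : seq 'I_J) :
  homog (\sum_(j <- s) mult j) (\prod_(j <- s) ('X - (lam j)%:P) ^+ mult j) =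
  \prod_(j <- s) (1 - iot (lam j) * K) ^+ mult j.
Proof.
elim: s => [|j s IH].
  rewrite !big_nil; transitivity (homog 0 'X^0); first by rewrite expr0.
  by rewrite homogXn.
rewrite !big_cons addnC homog_mulXsubCn ?IH//.
elim: s {IH} => [|k s IH]; first by rewrite !big_nil size_poly1.
by rewrite !big_cons (leq_trans (size_mul_leq _ _))// size_exp_XsubC addSn/= -addnS leq_add2l.
Qed.

(** Each factor 1 - lam j K of the homogenized denominator has the inverse 1
    + lam j (L j). *)
Lemma homog_denom_inv : exists V, V * homog m D = 1.
Proof.
exists (iot c^-1 * \prod_(j < J) (1 + iot (lam j) * L j) ^+ mult j).
rewrite /D /denom homogZ homog_prod mulrACA -rmorphM mulVf// rmorph1 mul1r.
rewrite -big_split/= big1// => j _; rewrite -exprMn.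
rewrite (_ : _ * _ = 1) ?expr1n//.
transitivity (1 + iot (lam j) * (L j - (K + iot (lam j) * (K * L j)))); first ring.
by rewrite -LK subrr mulr0 addr0.
Qed.

(** The substitution z = 1/K in a partial fraction decomposition, with
    denominators cleared: 1/(z - lam j) becomes L j. *)
Lemma homog_pfsum e a :
  homog m (e *: D + pfsum lam c mult a) =
  (iot e + \sum_(j < J) \sum_(1 <= i < (mult j).+1) iot (a j i) * L j ^+ i) * homog m D.
Proof.
rewrite homogD homogZ mulrDl; congr (_ + _).
rewrite homog_sum mulr_suml; apply: eq_bigr => j _.
rewrite homog_sum mulr_suml; apply: eq_big_nat => i /andP[_ ij].
by rewrite homogZ homog_pfbasis// mulrA.
Qed.

End Homogenization.

(** * Factorization by roots and multiplicities *)

Section RootFactorization.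
Variables (F : closedFieldType).

Lemma mup_prodXsubC (c : F) (r : seq F) z : c != 0 ->
  mup z (c *: \prod_(x <- r) ('X - x%:P)) = count_mem z r.
Proof.
move=> c0; have P0 (s : seq F) : \prod_(x <- s) ('X - x%:P) != 0.
  by rewrite monic_neq0// monic_prod_XsubC.
have -> : mup z (c *: \prod_(x <- r) ('X - x%:P)) = mup z (\prod_(x <- r) ('X - x%:P)).
  rewrite -mul_polyC mupMr// rootC c0//.
elim: r => [|x r IH]; first by rewrite big_nil mupNroot// root1.
rewrite big_cons mupM ?polyXsubC_eq0// IH -['X - x%:P]expr1 mup_XsubCX/=.
by case: eqP.
Qed.

(** Over an algebraically closed field the polynomial is a product of linear
    factors; grouping equal ones counts multiplicities. *)
Lemma root_factorization (p : {poly F}) (J : nat) (lam : 'I_J -> F) : p != 0 ->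
  injective lam -> (forall z, root p z <-> exists j, z = lam j) ->
  p = denom lam (lead_coef p) (fun j => mup (lam j) p).
Proof.
move=> p0 lam_inj rts; have [r E] := closed_field_poly_normal p.
have l0 : lead_coef p != 0 by rewrite lead_coef_eq0.
have mr j : mup (lam j) p = count_mem (lam j) r by rewrite {1}E mup_prodXsubC.
have perm : perm_eq (undup r) [seq lam j | j <- enum 'I_J].
  apply: uniq_perm => [||z]; first exact: undup_uniq.
    by rewrite map_inj_uniq// enum_uniq.
  rewrite mem_undup; have -> : (z \in r) = root p z.
    by rewrite E rootZ// root_prod_XsubC.
  apply/idP/mapP => [/rts[j ->]|[j _ ->]]; first by exists j; rewrite ?mem_enum.
  by apply/rts; exists j.
rewrite {1}E /denom; congr (_ *: _); under [RHS]eq_bigr do rewrite mr.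
rewrite -prodr_undup_exp_count (perm_big _ perm)/= big_map enumT.
by [].
Qed.

End RootFactorization.

Lemma poly_eq0_horner (F : numFieldType) (p : {poly F}) :
  (forall z, p.[z] = 0) -> p = 0.
Proof.
move=> H; apply/eqP/negP => /negP p0.
pose s := [seq (i%:R : F) | i <- iota 0 (size p)].
have : (size s < size p)%N.
  apply: max_poly_roots => //.
    by apply/allP => z _; rewrite /root H.
  by rewrite map_inj_uniq ?iota_uniq// => i j /eqP; rewrite eqr_nat => /eqP.
by rewrite size_map size_iota ltnn.
Qed.

(** * The polynomials of the Cauchy problem *)

Section CoefficientPolynomials.
Variables (R : realType) (m : nat) (c : nat -> R[i]).

Lemma coef_charpol i : (charpol m c)`_i = if (i < m.+1)%N then c i else 0.
Proof. by rewrite coef_poly. Qed.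

Lemma coef_numpol p i :
  (numpol m c p)`_i = if (0 < i <= m - p)%N then c (p + i)%N else 0.
Proof.
have -> : numpol m c p = \poly_(i < (m - p).+1) (if i == 0%N then 0 else c (p + i)%N).
  rewrite poly_def -(big_mkord xpredT (fun i => (if i == 0%N then 0 else c (p + i)%N) *: 'X^i)).
  rewrite big_ltn// eqxx scale0r add0r; apply: eq_big_nat => j /andP[j0 _].
  by rewrite gtn_eqF.
by rewrite coef_poly ltnS; case: i => [|i]; rewrite ?if_same.
Qed.

(** Horner recurrence, downwards from the value 0 at p = m. *)
Lemma numpolS p : (p < m)%N ->
  numpol m c p = 'X * (numpol m c p.+1 + (c p.+1)%:P).
Proof.
move=> pm; apply/polyP => -[|i]; rewrite coefXM/= coef_numpol//.
rewrite coefD coefC coef_numpol; case: i => [|i] /=.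
  by rewrite add0r addn1 subn_gt0 pm.
by rewrite addr0 addSnnS; congr (if _ then _ else _); apply/idP/idP; lia.
Qed.

Lemma numpol0 : numpol m c 0 = charpol m c - (c 0%N)%:P.
Proof.
apply/polyP => i; rewrite coefB coefC coef_numpol coef_charpol subn0 add0n ltnS.
by case: i => [|i] /=; rewrite ?subrr ?subr0.
Qed.

Lemma numpolm : numpol m c m = 0.
Proof. by apply/polyP => i; rewrite coef_numpol subnn coef0; case: i. Qed.

Lemma size_numpol p : (size (numpol m c p) <= (m - p).+1)%N.
Proof. by apply/leq_sizeP => i mi; rewrite coef_numpol (leqNgt i) mi andbF. Qed.

(** For p = 0 the numerator is the denominator minus a constant, hence the
    polynomial part 1; for the other p the fraction is proper. *)
Lemma size_numpolB p : (0 < m)%N -> (p < m)%N ->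
  (size (numpol m c p - (if p == 0%N then 1 else 0) *: charpol m c)%R <= m)%N.
Proof.
move=> m0 pm; case: p pm => [|p] pm /=.
  rewrite scale1r numpol0 addrAC subrr sub0r size_polyN (leq_trans (size_polyC_leq1 _))//.
rewrite scale0r subr0 (leq_trans (size_numpol _))//; lia.
Qed.

Variables (A : comNzRingType) (iot : {rmorphism R[i] -> A}) (K : A).

Lemma homog_charpol : homog iot K m (charpol m c) =
  \sum_(p < m.+1) iot (c p) * K ^+ (m - p).
Proof. by apply: eq_bigr => i _; rewrite coef_charpol ltn_ord. Qed.

Lemma homog_const (a : R[i]) : homog iot K m a%:P = iot a * K ^+ m.
Proof.
have h1 : homog iot K m 1 = K ^+ m.
  by have := @homogXn _ _ iot K m 0 isT; rewrite expr0 subn0.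
by rewrite -[a%:P]mulr1 mul_polyC homogZ h1.
Qed.

Lemma homog_numpolS p : (p < m)%N -> K * homog iot K m (numpol m c p) =
  homog iot K m (numpol m c p.+1) + iot (c p.+1) * K ^+ m.
Proof.
move=> pm; have [m' Em] : exists m', m = m'.+1 by exists m.-1; rewrite prednK//; lia.
have sr : (size (numpol m c p.+1 + (c p.+1)%:P)%R <= m'.+1)%N.
  rewrite (leq_trans (size_polyD _ _))// geq_max (leq_trans (size_numpol _)) ?(leq_trans (size_polyC_leq1 _))//; lia.
rewrite -homog_const -homogD (numpolS pm); move: sr; set r := _ + _ => sr.
rewrite [in LHS]Em [in RHS]Em (homogS _ _ sr); congr (_ * _).
have -> : 'X = 'X - 0%:P :> {poly R[i]} by rewrite subr0.
by rewrite homog_mulXsubC// rmorph0 mul0r subr0 mul1r.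
Qed.

(** Abel summation: by Horner, the homogenized numerators satisfy K H_p =
    H_(p+1) + c_(p+1) K^m, so replacing G p by Y p - K Y (p+1) makes the sum
    of the H_p G p telescope. *)
Lemma cauchy_identity (Y G : nat -> A) (f : A) :
  (forall p, (p < m)%N -> Y p = G p + K * Y p.+1) ->
  \sum_(p < m.+1) iot (c p) * Y p = f ->
  homog iot K m (charpol m c) * Y 0%N =
    K ^+ m * f + \sum_(p < m) homog iot K m (numpol m c p) * G p.
Proof.
move=> YG fE; pose H p := homog iot K m (numpol m c p).
have tele r : (r <= m)%N -> \sum_(p < r) H p * G p =
    H 0%N * Y 0%N - K ^+ m * (\sum_(p < r) iot (c p.+1) * Y p.+1) - H r * Y r.
  elim: r => [|r IH] rm; first by rewrite !big_ord0 mulr0 subr0 subrr.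
  rewrite !big_ord_recr/= IH 1?ltnW// (YG r rm).
  have -> : H r.+1 = K * H r - iot (c r.+1) * K ^+ m by rewrite /H homog_numpolS// addrK.
  ring.
rewrite -[X in _ + X]/(\sum_(p < m) H p * G p) (tele m (leqnn m)).
have -> : H m = 0 by rewrite /H numpolm homog0.
have -> : H 0%N = homog iot K m (charpol m c) - iot (c 0%N) * K ^+ m.
  by rewrite /H numpol0 homogD -scaleN1r homogZ homog_const rmorphN1 mulN1r.
rewrite -fE big_ord_recl/=.
have -> : \sum_(i < m) iot (c (bump 0 i)) * Y (bump 0 i) =
  \sum_(i < m) iot (c i.+1) * Y i.+1 by [].
move: (\sum_(i < m) _) => S; ring.
Qed.

End CoefficientPolynomials.

(** * Coefficients of partial fractions *)

Section PartialFractionCoefs.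
Variables (R : realType) (J : nat) (lam : 'I_J -> R[i]) (mult : 'I_J -> nat) (c : R[i]).
Hypotheses (lam_inj : injective lam) (c0 : c != 0).
Let D := denom lam c mult.

Lemma horner_pfsum a z : D.[z] != 0 -> (pfsum lam c mult a).[z] =
  (\sum_(j < J) \sum_(1 <= i < (mult j).+1) a j i / (z - lam j) ^+ i) * D.[z].
Proof.
move=> Dz; rewrite horner_sum mulr_suml; apply: eq_bigr => j _.
rewrite horner_sum mulr_suml; apply: eq_big_nat => i /andP[_ ij].
have DE : D.[z] = (z - lam j) ^+ i * (pfbasis lam c mult j i).[z].
  by rewrite /D (@denomE _ _ lam c mult j i ij) hornerM horner_exp hornerXsubC.
have z0 : (z - lam j) ^+ i != 0.
  by move: Dz; rewrite DE mulf_eq0 negb_or => /andP[].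
by rewrite hornerZ DE mulrA divfK.
Qed.

(** The two sides, multiplied by D, are polynomials that agree outside of
    the roots of D; one more factor D makes them agree everywhere. *)
Lemma is_partial_fractionP N e a : is_partial_fraction lam mult N D e a <->
  N = e *: D + pfsum lam c mult a.
Proof.
split=> [H|-> z Dz]; last first.
  rewrite hornerD hornerZ horner_pfsum// mulrDl !mulfK//.
apply/eqP; rewrite -subr_eq0; apply/eqP.
have D0 : D != 0 by rewrite -size_poly_eq0 size_denom.
have : (N - (e *: D + pfsum lam c mult a)) * D == 0.
  apply/eqP/poly_eq0_horner => z; rewrite hornerM.
  have [->|Dz] := eqVneq D.[z] 0; first by rewrite mulr0.
  rewrite hornerD hornerN hornerD hornerZ horner_pfsum// -mulrDl -H//.
  by rewrite divfK// subrr mul0r.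
by rewrite mulf_eq0 (negbTE D0) orbF => /eqP.
Qed.

Lemma partial_fraction_coefs_exist N e : 
  (size (N - e *: D)%R <= \sum_(j < J) mult j)%N ->
  exists a, partial_fraction_coefs lam mult N D e a /\ N = e *: D + pfsum lam c mult a.
Proof.
move=> sN; have [a aE] := pfsum_exists lam_inj c0 sN.
have NE : N = e *: D + pfsum lam c mult a by rewrite -aE addrC subrK.
exists a; split=> //; split; first exact/is_partial_fractionP.
move=> a' /is_partial_fractionP; rewrite NE => /addrI E j i ij.
apply/eqP; rewrite -subr_eq0; apply/eqP.
apply: (@pfsum_eq0 _ _ _ _ lam_inj c0 mult (fun j i => a' j i - a j i)) ij.
transitivity (pfsum lam c mult a' - pfsum lam c mult a); last by rewrite E subrr.
rewrite /pfsum -sumrB; apply: eq_bigr => j' _.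
by rewrite -sumrB; apply: eq_bigr => i' _; rewrite scalerBl.
Qed.

End PartialFractionCoefs.

(** * The Cauchy problem in the unitization *)

Section CauchyProblem.
Variable R : realType.
Notation C := R[i].
Implicit Types (f g y kappa k : R -> C).

(** The causal extension as an element of the algebra; the value 0 is a
    default for functions outside of C_{-1}. *)
Definition tocfun f : cfun R :=
  if pselect (cCm1 (causal f)) is left H then cfun_of H else 0.

Lemma tocfun_causal f : inCm1 f -> tocfun f = causal f :> (R -> C).
Proof. by move=> /inCm1_causal fC; rewrite /tocfun; case: pselect. Qed.

Lemma tocfunE f t : inCm1 f -> 0 < t -> tocfun f t = f t.
Proof. by move=> fC t0; rewrite tocfun_causal// causalE. Qed.

Lemma tocfun_eq f (h : cfun R) : inCm1 f -> (forall t, 0 < t -> f t = h t) -> tocfun f = h.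
Proof.
move=> fC fh; apply: cfunP => t; have [t0|t0] := leP t 0.
  by rewrite !(cCm1_causal (cvalC _) t0).
by rewrite tocfunE// fh.
Qed.

Lemma cconv_lconv (h h' : cfun R) f f' : (forall t, 0 < t -> h t = f t) ->
  (forall t, 0 < t -> h' t = f' t) -> cconv h h' = lconv f f' :> (R -> C).
Proof. by move=> hf hf'; exact: eq_lconv. Qed.

Lemma eq_lconvpow g g' i t : (forall x, 0 < x -> g x = g' x) -> 0 < t ->
  lconvpow g i t = lconvpow g' i t.
Proof.
move=> gg; rewrite /lconvpow; elim: i.-1 t => [|j IH] t t0 /=; first exact: gg.
by rewrite (eq_lconv gg IH).
Qed.

Lemma lfun_resolvent kappa lam : inCm1 kappa -> exists L : cfun R,
  L = tocfun kappa + lam *: cconv (tocfun kappa) L /\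
  forall t, 0 < t -> L t = lfun kappa lam t.
Proof.
move=> kC; have [L [LE cv]] := resolvent_exists (tocfun kappa) lam.
exists L; split=> // t t0; apply/esym; rewrite /lfun.
rewrite (_ : (fun j => lam ^+ j * lconvpow kappa j.+1 t : C^o) =
             (fun j => neumann_term (tocfun kappa) lam j t)); last first.
  apply/funext => j; rewrite /neumann_term cfunZE cpowE; congr (_ * _).
  by apply: eq_lconvpow => // x x0; rewrite tocfunE.
exact: (cvg_lim (@norm_hausdorff _ _) (cv t)).
Qed.

(** The functions form an ideal of the unitization: solving a linear
    equation there returns a function, without a multiple of the unit. *)
Lemma uemb_ideal (V : unitization R) (g : cfun R) : exists v, V * uemb g = uemb v.
Proof. by exists (V * uemb g).2; congr (_, _); rewrite /= mulr0. Qed.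

Lemma uembD (g h : cfun R) : uemb (g + h) = uemb g + uemb h.
Proof. exact: raddfD. Qed.

Lemma uemb_sum (I : Type) (r : seq I) (P : pred I) (F : I -> cfun R) :
  \sum_(i <- r | P i) uemb (F i) = uemb (\sum_(i <- r | P i) F i).
Proof. by rewrite raddf_sum. Qed.

Variables (n m : nat) (kappa k : R -> C) (c : nat -> C).
Hypotheses (n_gt0 : (0 < n)%N) (m_gt0 : (0 < m)%N).
Hypothesis kappa_k : Lclass n kappa k.

Let kap := tocfun kappa.
Let kappaC : inCm1 kappa. Proof. by case: kappa_k. Qed.
Let kC : cCm1 (causal k).
Proof. by case: kappa_k => _ kC _; exact/inCm1_causal/inCm10_inCm1. Qed.
Let kapE t : 0 < t -> kap t = kappa t. Proof. exact: tocfunE. Qed.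
Let kk t : 0 < t -> lconv kappa k t = hfun n t. Proof. by case: kappa_k => _ _; apply. Qed.

Let K : unitization R := uemb kap.
Let Q : unitization R := homog (@uscal R) K m (charpol m c).

Lemma inKer_inCm1 g : inKer n k g -> inCm1 g.
Proof. by case=> -[]. Qed.

(** The initial conditions and the equation, read in the unitization, are
    the hypotheses of [cauchy_identity]. *)
Lemma cauchy_solution_formula f (gam : nat -> R -> C) y : inCm1 f ->
  (forall p, (p < m)%N -> inCm1 (gam p)) ->
  cauchy_solution n kappa k m c f gam y ->
  Q * uemb (tocfun y) = K ^+ m * uemb (tocfun f) +
    \sum_(p < m) homog (@uscal R) K m (numpol m c p) * uemb (tocfun (gam p)).
Proof.
move=> fC gC [[yC yk] eqn ini].
have Yp p : (p <= m)%N -> inCm1 (gfdn n k p y).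
  by case: p => [|p] pm //; have [] := yk p pm.
apply: (@cauchy_identity _ _ _ _ _ _ (fun p => uemb (tocfun (gfdn n k p y)))
          (fun p => uemb (tocfun (gam p)))) => [p pm|].
  rewrite uembM -raddfD; congr uemb; apply: tocfun_eq; first by apply: Yp; exact: ltnW.
  move=> t t0; rewrite cfunDE tocfunE//; last exact: gC.
  rewrite -ini// /projector (@cconv_lconv _ _ kappa (gfdn n k p.+1 y))//.
    by rewrite subrK.
  by move=> x x0; rewrite tocfunE//; exact: Yp.
under eq_bigr do rewrite uscalM.
rewrite uemb_sum; congr uemb; apply/esym/tocfun_eq => // t t0.
rewrite -eqn//; apply/esym.
rewrite (big_morph (fun h : cfun R => h t) (id1 := 0) (op1 := +%R))//.
by apply: eq_bigr => p _; rewrite cfunZE tocfunE//; apply: Yp; rewrite -ltnS.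
Qed.

Lemma cauchy_solution_unique f (gam : nat -> R -> C) y y' (V : unitization R) :
  V * Q = 1 -> inCm1 f -> (forall p, (p < m)%N -> inCm1 (gam p)) ->
  cauchy_solution n kappa k m c f gam y ->
  cauchy_solution n kappa k m c f gam y' -> forall t, 0 < t -> y' t = y t.
Proof.
move=> VQ fC gC sy sy' t t0.
have E : uemb (tocfun y') = uemb (tocfun y).
  rewrite -[LHS]mul1r -[RHS]mul1r -VQ -!mulrA.
  by rewrite (cauchy_solution_formula fC gC sy) (cauchy_solution_formula fC gC sy').
have yC : inCm1 y by case: sy => -[].
have yC' : inCm1 y' by case: sy' => -[].
by rewrite -(tocfunE yC t0) -(tocfunE yC' t0) (uemb_inj E).
Qed.

(** From v = D^<m> y, r steps back lead to D^<m-r> y, each of them by an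
    initial condition D^<p> y = gamma_p + K D^<p+1> y. *)
Fixpoint backward_solution (G : nat -> cfun R) (v : cfun R) (r : nat) : cfun R :=
  if r is r'.+1 then G (m - r)%N + cconv kap (backward_solution G v r') else v.

Lemma backward_solution_linear G v r :
  uemb (backward_solution G v r) = uemb (backward_solution G 0 r) + K ^+ r * uemb v.
Proof.
elim: r => [|r IH] /=; first by rewrite raddf0 add0r mul1r.
by rewrite !uembD -!uembM IH mulrDr addrA exprS mulrA.
Qed.

(** With v = D^<m> y as unknown, the initial conditions express all D^<p> y
    by [backward_solution], as constant terms plus K^(m-p) v. The equation
    becomes W + Q v = f, where W collects the constant terms, and Q is
    invertible. That the functions so obtained are the successive fractional
    derivatives of the first one is [gfd_step]. *)
Lemma cauchy_solution_exists f (gam : nat -> R -> C) (V : unitization R) :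
  V * Q = 1 -> inCm1 f -> (forall p, (p < m)%N -> inKer n k (gam p)) ->
  exists y, cauchy_solution n kappa k m c f gam y.
Proof.
move=> VQ fC gk; pose G p := tocfun (gam p).
pose W := \sum_(p < m.+1) c p *: backward_solution G 0 (m - p).
have [v vE] := uemb_ideal V (tocfun f - W).
pose Y p := backward_solution G v (m - p).
have YS p : (p < m)%N -> Y p = G p + cconv kap (Y p.+1).
  by move=> pm; rewrite /Y -(subnSK pm)/= subnSK// subKn// ltnW.
have Yeq : \sum_(p < m.+1) c p *: Y p = tocfun f.
  apply: uemb_inj; rewrite -uemb_sum.
  transitivity (uemb W + Q * uemb v).
    rewrite /W -uemb_sum /Q homog_charpol mulr_suml -big_split/=.
    by apply: eq_bigr => p _; rewrite /Y -!uscalM backward_solution_linear mulrDr mulrA.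
  by rewrite -vE mulrA [Q * V]mulrC VQ mul1r -raddfD addrC subrK.
pose y : R -> C := Y 0%N.
have step p : (p < m)%N -> forall F, (forall t, 0 < t -> F t = Y p t) ->
    cderivablen n (lconv k F) /\ forall t, 0 < t -> gfd n k F t = Y p.+1 t.
  move=> pm F FY; apply: (gfd_step n_gt0 kC kapE kk (gk p pm)) => t t0.
  by rewrite FY// YS// cfunDE tocfunE//; exact/inKer_inCm1/gk.
have yY p : (p <= m)%N -> forall t, 0 < t -> gfdn n k p y t = Y p t.
  elim: p => [//|p IH] pm t t0.
  by have [_ H] := step p pm (gfdn n k p y) (IH (ltnW pm)); exact: H.
exists y; split.
- split; first by apply: (cCm1_inCm1 (cvalC (Y 0%N))).
  move=> p pm; have [dv _] := step p pm _ (yY p (ltnW pm)).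
  by split=> //; apply: (cCm1_inCm1 (cvalC (Y p.+1))); exact: yY.
- move=> t t0; rewrite -(tocfunE fC t0) -Yeq.
  rewrite (big_morph (fun h : cfun R => h t) (id1 := 0) (op1 := +%R))//.
  by apply: eq_bigr => p _; rewrite cfunZE yY// -ltnS.
- move=> p pm t t0; rewrite /projector (yY p (ltnW pm))// YS// cfunDE.
  rewrite (@cconv_lconv kap (Y p.+1) kappa (gfdn n k p.+1 y))//; last first.
    by move=> x x0; rewrite (yY p.+1 pm).
  by rewrite addrK tocfunE//; exact/inKer_inCm1/gk.
Qed.

End CauchyProblem.

(** * Sums of powers of resolvents *)

Section ResolventSums.
Variables (R : realType) (J : nat) (mult : 'I_J -> nat) (L : 'I_J -> cfun R).
Implicit Types b : 'I_J -> nat -> R[i].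

Definition resolvent_sum b : cfun R :=
  \sum_(j < J) \sum_(1 <= i < (mult j).+1) b j i *: cpow (L j) i.-1.

Lemma uemb_resolvent_sum b :
  \sum_(j < J) \sum_(1 <= i < (mult j).+1) uscal (b j i) * uemb (L j) ^+ i =
  uemb (resolvent_sum b).
Proof.
rewrite -uemb_sum; apply: eq_bigr => j _; rewrite -uemb_sum.
apply: eq_big_nat => i /andP[i0 _].
by rewrite -uscalM uemb_cpow prednK.
Qed.

Lemma cconv_resolvent_sum (l : 'I_J -> R -> R[i]) b (g : R -> R[i]) t :
  (forall j x, 0 < x -> L j x = l j x) -> inCm1 g -> 0 < t ->
  cconv (resolvent_sum b) (tocfun g) t =
  \sum_(j < J) \sum_(1 <= i < (mult j).+1)
    b j i * lconv g (lconvpow (l j) i) t.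
Proof.
move=> Ll gC t0; rewrite cconvC.
have -> : cconv (tocfun g) (resolvent_sum b) =
    \sum_(j < J) \sum_(1 <= i < (mult j).+1)
      b j i *: cconv (tocfun g) (cpow (L j) i.-1).
  have cs0 : cconv (tocfun g) 0 = 0 by rewrite cconvC cconv0.
  rewrite (big_morph _ (cconvDr (tocfun g)) cs0); apply: eq_bigr => j _.
  rewrite (big_morph _ (cconvDr (tocfun g)) cs0); apply: eq_bigr => i _.
  by rewrite cconvZr.
rewrite (big_morph (fun h : cfun R => h t) (id1 := 0) (op1 := +%R))//.
apply: eq_bigr => j _.
rewrite (big_morph (fun h : cfun R => h t) (id1 := 0) (op1 := +%R))//.
apply: eq_big_nat => i /andP[i0 _].
rewrite cfunZE; congr (_ * _).
rewrite (@cconv_lconv R _ _ g (lconvpow (l j) i))// => x x0.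
  by rewrite tocfunE.
by rewrite cpowE prednK//; apply: eq_lconvpow => // z z1; exact: Ll.
Qed.

End ResolventSums.

(** * Solution of the Cauchy problem *)

Local Open Scope complex_scope.

Theorem theorem4p2 (R : realType) (n m : nat) (kappa k f : R -> R[i])
    (c : nat -> R[i]) (gam : nat -> R -> R[i])
    (J : nat) (lam : 'I_J -> R[i]) (mult : 'I_J -> nat)
    (n_gt0 : (0 < n)%N) (m_gt0 : (0 < m)%N)
    (kappa_k : Lclass n kappa k) (kappa_reg : inCm1l n.-1 kappa)
    (f_Cm1 : inCm1 f) (cm_neq0 : c m != 0)
    (gam_ker : forall p, (p < m)%N -> inKer n k (gam p))
    (lam_inj : injective lam)
    (lam_roots : forall z : R[i],
       root (charpol m c) z <-> exists j : 'I_J, z = lam j)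
    (mult_lam : forall j : 'I_J, mult j = mup (lam j) (charpol m c)) :
  [/\ (\sum_(j < J) mult j)%N = m,
      charpol m c = c m *: \prod_(j < J) ('X - (lam j)%:P) ^+ mult j &
      exists (a : 'I_J -> nat -> R[i]) (ap : nat -> 'I_J -> nat -> R[i])
             (y yf yiv : R -> R[i]),
        [/\ (* the constants c_ij and c_ijp *)
            partial_fraction_coefs lam mult 1 (charpol m c) 0 a /\
            (forall p, (p < m)%N ->
               partial_fraction_coefs lam mult (numpol m c p) (charpol m c)
                 (if p == 0%N then 1 else 0) (ap p)),
            unique_cauchy_solution n kappa k m c f gam y,
            forall t : R, 0 < t -> y t = yf t + yiv t,
            unique_cauchy_solution n kappa k m c f (fun _ _ => 0) yf /\
            (forall t : R, 0 < t ->
               yf t = \sum_(j < J) \sum_(1 <= i < (mult j).+1)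
                        a j i * lconv f (lconvpow (lfun kappa (lam j)) i) t) &
            unique_cauchy_solution n kappa k m c (fun _ => 0) gam yiv /\
            (forall t : R, 0 < t ->
               yiv t = gam 0%N t +
                 \sum_(p < m) \sum_(j < J) \sum_(1 <= i < (mult j).+1)
                   ap p j i *
                   lconv (gam p) (lconvpow (lfun kappa (lam j)) i) t)]].
Proof.
have sP : size (charpol m c) = m.+1 by rewrite size_poly_eq.
have P0 : charpol m c != 0 by rewrite -size_poly_eq0 sP.
have lP : lead_coef (charpol m c) = c m by rewrite lead_coefE sP coef_charpol ltnSn.
have PD : charpol m c = denom lam (c m) mult.
  rewrite {1}(root_factorization P0 lam_inj lam_roots) lP /denom.
  by congr (_ *: _); apply: eq_bigr => j _; rewrite mult_lam.
have sm : (\sum_(j < J) mult j)%N = m.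
  by apply/succn_inj; rewrite -sP PD size_denom.
split=> //.
have [kappaC _ _] := kappa_k.
have gC p : (p < m)%N -> inCm1 (gam p) by move=> pm; exact/inKer_inCm1/gam_ker.
have z0C : inCm1 (fun=> 0 : R[i]).
  by apply: (cCm1_inCm1 (cCm1_0 R)).
have kC : cCm1 (causal k) by have [_ kC _] := kappa_k; exact/inCm1_causal/inCm10_inCm1.
have ker0 : inKer n k (fun=> 0).
  apply: (@gfd_inKer0 R n kappa k (tocfun kappa) n_gt0 kC); first by move=> t t0; rewrite tocfunE.
  by case: kappa_k.
have /all_sig[L /all_and2[LE Ll]] : forall j, {L : cfun R | L = tocfun kappa + lam j *: cconv (tocfun kappa) L /\
    forall t, 0 < t -> L t = lfun kappa (lam j) t}.
  by move=> j; apply: cid; exact: lfun_resolvent.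
pose K : unitization R := uemb (tocfun kappa).
pose Q := homog (@uscal R) K m (charpol m c).
have LK j : uemb (L j) = K + uscal (lam j) * (K * uemb (L j)).
  by rewrite uembM uscalM -uembD -LE.
(* Q is K^m P(1/K); V is its inverse. *)
have [V VQ] : exists V, V * Q = 1.
  have [V] := homog_denom_inv mult cm_neq0 LK.
  by rewrite sm -PD => VQ; exists V.
have hom e a : V * homog (@uscal R) K m (e *: charpol m c + pfsum lam (c m) mult a) =
    uscal e + \sum_(j < J) \sum_(1 <= i < (mult j).+1) uscal (a j i) * uemb (L j) ^+ i.
  have := homog_pfsum mult lam_inj cm_neq0 LK e a.
  by rewrite sm -PD => ->; rewrite mulrCA VQ mulr1.
(* The decompositions are kept as polynomial identities too, in order to be
   homogenized. For p >= m the value of ap is a dummy. *)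
have [a [aP aE]] : exists a, partial_fraction_coefs lam mult 1 (charpol m c) 0 a /\
    1 = 0 *: charpol m c + pfsum lam (c m) mult a.
  rewrite PD; apply: partial_fraction_coefs_exist => //.
  by rewrite scale0r subr0 size_poly1 sm.
have /all_sig[ap apP] : forall p, {ap | (p < m)%N ->
    partial_fraction_coefs lam mult (numpol m c p) (charpol m c) (if p == 0%N then 1 else 0) ap /\
    numpol m c p = (if p == 0%N then 1 else 0) *: charpol m c + pfsum lam (c m) mult ap}.
  move=> p; apply: cid; have [pm|pm] := ltnP p m; last by exists a.
  have [ap apP] : exists ap, partial_fraction_coefs lam mult (numpol m c p) (charpol m c)
      (if p == 0%N then 1 else 0) ap /\
      numpol m c p = (if p == 0%N then 1 else 0) *: charpol m c + pfsum lam (c m) mult ap.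
    rewrite PD; apply: partial_fraction_coefs_exist => //.
    by rewrite sm -PD size_numpolB.
  by exists ap.
pose Gf := resolvent_sum mult L a.
pose Gp p := resolvent_sum mult L (ap p).
have VK : V * K ^+ m = uemb Gf.
  have <- : homog (@uscal R) K m 1 = K ^+ m by have := @homogXn _ _ (@uscal R) K m 0 isT; rewrite expr0 subn0.
  by rewrite {1}aE hom rmorph0 add0r uemb_resolvent_sum.
have VN p : (p < m)%N -> V * homog (@uscal R) K m (numpol m c p) =
    uscal (if p == 0%N then 1 else 0) + uemb (Gp p).
  by move=> pm; have [_ {1}->] := apP p pm; rewrite hom uemb_resolvent_sum.
(* Dividing the ring form of the problem by Q. The unit coming from the
   partial fraction of P_0 produces the summand gamma_0. *)
have formula (f' : R -> R[i]) gam' y : inCm1 f' -> (forall p, (p < m)%N -> inCm1 (gam' p)) ->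
    cauchy_solution n kappa k m c f' gam' y ->
    tocfun y = cconv Gf (tocfun f') + (tocfun (gam' 0%N) + \sum_(p < m) cconv (Gp p) (tocfun (gam' p))).
  move=> f'C g'C sy; apply: uemb_inj.
  rewrite -[LHS]mul1r -VQ -mulrA (cauchy_solution_formula kappa_k f'C g'C sy).
  rewrite mulrDr mulrA VK !uembD -uembM; congr (_ + _).
  rewrite -uemb_sum mulr_sumr.
  transitivity (\sum_(p < m) (uscal (if p == 0%N :> nat then 1 else 0) * uemb (tocfun (gam' p))
     + uemb (Gp p) * uemb (tocfun (gam' p)))).
    by apply: eq_bigr => p _; rewrite mulrA VN// mulrDl.
  rewrite big_split/=; congr (_ + _); last by apply: eq_bigr => p _; rewrite uembM.
  rewrite (bigD1 (Ordinal m_gt0))//= rmorph1 mul1r big1 ?addr0// => p.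
  by rewrite -val_eqE/= => /negbTE ->; rewrite rmorph0 mul0r.
have sol f' gam' : inCm1 f' -> (forall p, (p < m)%N -> inKer n k (gam' p)) ->
    exists y, unique_cauchy_solution n kappa k m c f' gam' y.
  move=> f'C g'K; have [y sy] := cauchy_solution_exists n_gt0 kappa_k VQ f'C g'K.
  exists y; split=> // y' sy'.
  apply: (cauchy_solution_unique kappa_k VQ f'C _ sy sy') => p pm.
  exact/inKer_inCm1/g'K.
have tz : tocfun (fun=> 0 : R[i]) = 0 by apply: tocfun_eq.
have [y ysol] := sol f gam f_Cm1 gam_ker.
have [yf yfsol] := sol f (fun _ _ => 0) f_Cm1 (fun p _ => ker0).
have [yiv yivsol] := sol (fun=> 0) gam z0C gam_ker.
have yE := formula _ _ _ f_Cm1 gC ysol.1.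
have yfE := formula _ _ _ f_Cm1 (fun p _ => z0C) yfsol.1.
have yivE := formula _ _ _ z0C gC yivsol.1.
have inC f' gam' y' : unique_cauchy_solution n kappa k m c f' gam' y' -> inCm1 y'.
  by case=> -[[]].
have c0r (h : cfun R) : cconv h 0 = 0 by rewrite cconvC cconv0.
have {}yfE : tocfun yf = cconv Gf (tocfun f).
  by rewrite yfE tz big1 ?add0r ?addr0// => p _; rewrite c0r.
have {}yivE : tocfun yiv = tocfun (gam 0%N) + \sum_(p < m) cconv (Gp p) (tocfun (gam p)).
  by rewrite yivE tz c0r add0r.
exists a, ap, y, yf, yiv; split.
- by split=> // p pm; have [] := apP p pm.
- exact: ysol.
- move=> t t0; rewrite -(tocfunE (inC _ _ _ ysol) t0) yE -yfE -yivE.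
  by rewrite cfunDE (tocfunE (inC _ _ _ yfsol) t0) (tocfunE (inC _ _ _ yivsol) t0).
- split=> // t t0; rewrite -(tocfunE (inC _ _ _ yfsol) t0) yfE.
  exact: cconv_resolvent_sum.
- split=> // t t0; rewrite -(tocfunE (inC _ _ _ yivsol) t0) yivE cfunDE tocfunE//; last exact: gC.
  congr (_ + _).
  rewrite (big_morph (fun h : cfun R => h t) (id1 := 0) (op1 := +%R))//; apply: eq_bigr => p _.
  by apply: cconv_resolvent_sum => //; exact: gC.
Qed.
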